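(* There is a universal constant $C$ such that the following holds. Let $(E,\mathcal{B},P,B_0,\alpha)$ be a conservative interleaving bandit with $E=[L]$, matroid rank $K$ and $\alpha=1/K$, and let the algorithm I-UCB2 be run on it with horizon $n\ge 2$ (a multiple of $K$). Then its expected $n$-step regret satisfies $$R(n)\ \le\ (K-1)\left(48\sum_{e^\ast\in A^\ast}\frac{1}{\Delta^\ast_{e^\ast,\min}}+36\sum_{e\in E\setminus A^\ast}\frac{1}{\Delta_{e,\min}}+48\sum_{e'\in B_0}\frac{1}{\Delta'_{e',\min}}\right)\log n+24\sum_{e\in E\setminus A^\ast}\frac{1}{\Delta_{e,\min}}\log n+c,$$ where $c\le C\,KL\sqrt{\log n}$, i.e. $c=O(KL\sqrt{\log n})$.
   Context: **Problem.** A conservative interleaving bandit is a tuple $(E,\mathcal{B},P,B_0,\alpha)$: $E=[L]=\{1,\dots,L\}$ is a finite set of items; $\mathcal{B}$ is the collection of bases of a matroid on $E$ of rank $K$ (each basis has $K$ elements); $P$ is a probability distribution on $[0,1]^L$ (unknown to the learner); $B_0\in\mathcal{B}$ is the input baseline basis; $\alpha\in[0,1]$ is a tolerance. $\bar w=\mathbb{E}_{w\sim P}[w]$ denotes the vector of expected weights. Each time the learner takes an action $A\in\mathcal{B}$, a fresh weight vector $w\sim P$, independent of the past, is drawn, and the learner observes $w(e)$ for every $e\in A$ (semi-bandit feedback) and receives reward $\sum_{e\in A}w(e)$. **Regret and gaps.** $A^\ast\in\arg\max_{A\in\mathcal{B}}\sum_{e\in A}\bar w(e)$ is the optimal basis.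 If $A_1,\dots,A_n$ are the actions taken and $w_1,\dots,w_n$ the corresponding weight draws, the expected $n$-step regret is $R(n)=\mathbb{E}\big[\sum_{t=1}^n\big(\sum_{e\in A^\ast}w_t(e)-\sum_{e\in A_t}w_t(e)\big)\big]$. For $e\in E\setminus A^\ast$, $\Delta_{e,\min}=\min\{\bar w(e^\ast)-\bar w(e): e^\ast\in A^\ast,\ \bar w(e^\ast)>\bar w(e)\}$. For $e^\ast\in A^\ast$, $\Delta^\ast_{e^\ast,\min}=\min\{\bar w(e^\ast)-\bar w(e): e\in E\setminus A^\ast,\ \bar w(e^\ast)>\bar w(e)\}$. For $e'\in B_0$, $\Delta'_{e',\min}=\min\{\bar w(e)-\bar w(e'): e\in E\setminus B_0,\ \bar w(e)>\bar w(e')\}$. A minimum over the empty set is $+\infty$, with $1/\infty=0$. **Bijective exchange (known matroid fact).** For any two bases $B_1,B_2$ there is a bijection $\rho:B_1\to B_2$ such that $(B_1\setminus\{e\})\cup\{\rho(e)\}\in\mathcal{B}$ for every $e\in B_1$. **Algorithm I-UCB2 (the means of the items of $B_0$ are not known to the learner).** Let $c_{n,s}=\sqrt{1.5\log(n)/s}$. Initialization: one vector $w_0\sim P$ is observed in full (not counted in the regret), so every item has one observation. The algorithm then proceeds in rounds $r=1,2,\dots,n/K$; each round consists of $K$ actions, so there are $n$ actions (steps) in total. For item $e$ let $T_{r-1}(e)$ be the number of observations of $e$ made before round $r$ (including the initial one), and let $\hat w_{s}(e)$ be the average of its first $s$ observed weights. In round $r$: 1. Compute, for all $e\in E$, $U_r(e)=\hat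 w_{T_{r-1}(e)}(e)+c_{n,T_{r-1}(e)}$ and $L_r(e)=\max\{\hat w_{T_{r-1}(e)}(e)-c_{n,T_{r-1}(e)},0\}$. 2. Let the decision set $D_r$ be a maximum-weight basis with respect to the weights $U_r$. 3. Set $v_r(e)=U_r(e)$ for $e\in B_0$ and $v_r(e)=L_r(e)$ for $e\in E\setminus B_0$; let the baseline set $B_r$ be a maximum-weight basis with respect to the weights $v_r$. 4. Let $\rho_r:B_r\to D_r$ be a bijection as in the bijective exchange fact. For each $e\in B_r$ in turn, take the action $(B_r\setminus\{e\})\cup\{\rho_r(e)\}$, observe the weights of its items under a fresh draw from $P$, and update the statistics.
   Formalization: The optimal basis A* is assumed to be unique; with several optimal bases the stated inequality can fail, for instance when many tied optimal items outside the baseline have infinite gap and so contribute nothing to the right-hand side. *)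

(* Defs.v *)
From HB Require Import structures.
From mathcomp Require Import all_boot all_order all_algebra.
From mathcomp Require Import all_classical all_reals all_analysis.

Set Implicit Arguments.
Unset Strict Implicit.
Unset Printing Implicit Defensive.

Import Order.TTheory GRing.Theory Num.Theory.

Local Open Scope classical_set_scope.
Local Open Scope ring_scope.

(* Items are numbered from 0, so that E = [L] is 'I_L.  The law P lives on the
   product sigma-algebra of R^L and is carried by the cube [0,1]^L. *)
Record bandit (R : realType) (L K : nat) := Bandit {
  bases : {set {set 'I_L}};
  bases_neq0 : bases != finset.set0;
  bases_exchange : forall B1 B2 : {set 'I_L}, B1 \in bases -> B2 \in bases ->
    forall x, x \in B1 :\: B2 ->
    exists2 y, y \in B2 :\: B1 & y |: (B1 :\ x) \in bases;
  bases_rank : forall B : {set 'I_L}, B \in bases -> #|B| = K;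
  law : probability (L.-tuple (measurableTypeR R)) R;
  law_cube : law [set w | forall e, 0 <= tnth w e <= 1] = 1%E;
  base0 : {set 'I_L};
  base0_basis : base0 \in bases;
  tol : R;
  tol01 : 0 <= tol <= 1
}.

Section Bandit.
Context (R : realType) (L K : nat) (b : bandit R L K).

Definition wbar (e : 'I_L) : R := fine 'E_(law b)[fun w => tnth w e].

Definition weight (v : 'I_L -> R) (A : {set 'I_L}) : R := \sum_(e in A) v e.

Definition max_basis (v : 'I_L -> R) (A : {set 'I_L}) : Prop :=
  A \in bases b /\
  forall A' : {set 'I_L}, A' \in bases b -> weight v A' <= weight v A.

(* The three families of gaps; they are +oo when no item qualifies, and then
   their inverse in \bar R is 0. *)
Definition gap (As : {set 'I_L}) (e : 'I_L) : \bar R :=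
  \big[Order.min/+oo%E]_(e' in As | wbar e < wbar e') (wbar e' - wbar e)%:E.

Definition gap_star (As : {set 'I_L}) (e' : 'I_L) : \bar R :=
  \big[Order.min/+oo%E]_(e in ~: As | wbar e < wbar e') (wbar e' - wbar e)%:E.

Definition gap_base0 (e' : 'I_L) : \bar R :=
  \big[Order.min/+oo%E]_(e in ~: base0 b | wbar e' < wbar e)
    (wbar e - wbar e')%:E.

End Bandit.

(* past t collects the events determined by everything that happened up to and
   including the t-th draw (draws, internal randomization of the learner).
   draw 0 is the initial, fully observed, vector; draw t is the weight vector
   of the t-th action, t >= 1. *)
Record environment (R : realType) (L K : nat) (b : bandit R L K)
    (d : measure_display) (Omega : measurableType d)
    (Pr : probability Omega R) := Environment {
  past : nat -> set (set Omega);
  past_sigma_algebra : forall t, sigma_algebra setT (past t);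
  past_measurable : forall t, past t `<=` measurable;
  past_nondecreasing : forall t, past t `<=` past t.+1;
  draw : nat -> {RV Pr >-> L.-tuple (measurableTypeR R)};
  draw_past : forall t V, measurable V -> past t (draw t @^-1` V);
  draw_law : forall t V, measurable V -> distribution Pr (draw t) V = law b V;
  draw_fresh : forall t S V, past t S -> measurable V ->
    Pr (S `&` draw t.+1 @^-1` V) = (Pr S * Pr (draw t.+1 @^-1` V))%E
}.

Section Statistics.
Context (R : realType) (L K : nat) (b : bandit R L K) (d : measure_display)
  (Omega : measurableType d) (Pr : probability Omega R)
  (env : environment b Pr) (A : nat -> Omega -> {set 'I_L}) (n : nat).

(* A t is the t-th action, t >= 1.  Observed weights of e after t actions, in
   chronological order, starting with the initial one. *)
Definition observed (t : nat) (om : Omega) (e : 'I_L) : seq R :=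
  tnth (draw env 0 om) e ::
  [seq tnth (draw env i om) e | i <- iota 1 t & e \in A i om].

Definition nobs (t : nat) (om : Omega) (e : 'I_L) : nat :=
  size (observed t om e).

(* Average of the first s of the weights of e observed after t actions; it is
   meaningful for 0 < s <= nobs t om e. *)
Definition avg (t : nat) (om : Omega) (s : nat) (e : 'I_L) : R :=
  (\sum_(x <- take s (observed t om e)) x) / s%:R.

Definition radius (s : nat) : R := Num.sqrt (3 / 2 * ln n%:R / s%:R).

Definition ucb (t : nat) (om : Omega) (e : 'I_L) : R :=
  avg t om (nobs t om e) e + radius (nobs t om e).

Definition lcb (t : nat) (om : Omega) (e : 'I_L) : R :=
  Num.max (avg t om (nobs t om e) e - radius (nobs t om e)) 0.

Definition base_weight (t : nat) (om : Omega) (e : 'I_L) : R :=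
  if e \in base0 b then ucb t om e else lcb t om e.

End Statistics.

(* Runs of I-UCB2 with unspecified tie-breaking among maximum-weight bases,
   exchange bijections and enumeration orders; these choices need only be
   functions of the past.  Rounds are numbered from 0: round r comes after
   r * K actions, and its actions are those numbered r * K + 1, ..., r * K + K;
   out r i is the item of baseline r exchanged in the (i+1)-th of them. *)
Record iucb2_run (R : realType) (L K : nat) (b : bandit R L K) (n : nat)
    (d : measure_display) (Omega : measurableType d)
    (Pr : probability Omega R) := IUCB2Run {
  env : environment b Pr;
  action : nat -> Omega -> {set 'I_L};
  decision : nat -> Omega -> {set 'I_L};
  baseline : nat -> Omega -> {set 'I_L};
  exch : nat -> Omega -> {ffun 'I_L -> 'I_L};
  out : nat -> 'I_K -> Omega -> 'I_L;
  decision_past : forall r D, (r < n %/ K)%N ->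
    past env (r * K) (decision r @^-1` [set D]);
  baseline_past : forall r B, (r < n %/ K)%N ->
    past env (r * K) (baseline r @^-1` [set B]);
  exch_past : forall r f, (r < n %/ K)%N ->
    past env (r * K) (exch r @^-1` [set f]);
  out_past : forall r (i : 'I_K) e, (r < n %/ K)%N ->
    past env (r * K + i) (out r i @^-1` [set e]);
  decisionP : forall r om, (r < n %/ K)%N ->
    max_basis b (ucb env action n (r * K) om) (decision r om);
  baselineP : forall r om, (r < n %/ K)%N ->
    max_basis b (base_weight env action n (r * K) om) (baseline r om);
  exch_inj : forall r om, (r < n %/ K)%N ->
    {in baseline r om &, injective (exch r om)};
  exch_onto : forall r om, (r < n %/ K)%N ->
    exch r om @: baseline r om = decision r om;
  exch_basis : forall r om, (r < n %/ K)%N ->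
    forall e, e \in baseline r om ->
    exch r om e |: (baseline r om :\ e) \in bases b;
  (* as #|baseline r om| = K, each of its items is listed exactly once *)
  out_enum : forall r om, (r < n %/ K)%N ->
    [set out r i om | i : 'I_K]%SET = baseline r om;
  actionE : forall r om, (r < n %/ K)%N -> forall i : 'I_K,
    action (r * K + i).+1 om =
      exch r om (out r i om) |: (baseline r om :\ out r i om)
}.

Definition regret (R : realType) (L K : nat) (b : bandit R L K) (n : nat)
    (d : measure_display) (Omega : measurableType d)
    (Pr : probability Omega R) (X : iucb2_run b n Pr) (As : {set 'I_L}) :
    \bar R :=
  'E_Pr[fun om => \sum_(1 <= t < n.+1)
    (weight (tnth (draw (env X) t om)) As -
     weight (tnth (draw (env X) t om)) (action X t om))].

(* Main.v *)
(* The actions of round r have total mean regret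
   (K - 1) (w(A* ) - w(B_r)) + (w(A* ) - w(D_r)), w being the mean weight.

   Call round r accurate when every empirical mean is within its confidence radius
   c(e).  In an accurate round the regret is a sum of payments, each proportional to
   the radius c(x) of an item x observed in that round, and made only if c(x) is at
   least a fixed fraction of the corresponding minimal gap of x.  For D_r this follows
   from symmetric exchange with A*.  For B_r, the items of A* outside
   B_0, B_r and D_r, on which nothing is learnt, are first traded for items of D_r
   with at least the same upper confidence bound; the resulting basis H is then
   compared to B_r through a bijection that does not decrease the weights v_r.
   As x is observed at each payment and c(x) decreases like the inverse square root of
   the number of observations, the payments of x add up to O(log n / gap).

   For the deviations, exp (l S - l^2 N / 8) is a supermartingale along the run, S
   being the centered sum of the N observations of an item.  If a round is inaccurate,
   one of these supermartingales, with l = 4 c or - 4 c, is at least n^3; so n K / n^3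
   times their sum over items, rounds and possible values of N dominates the regret of
   an inaccurate run, and has expectation O(K L). *)
From HB Require Import structures.
Require Import Defs.
From mathcomp Require Import all_boot all_order all_algebra.
From mathcomp Require Import ring lra zify.

Set Implicit Arguments.
Unset Strict Implicit.
Unset Printing Implicit Defensive.

Import Order.TTheory GRing.Theory Num.Theory.

(** * Exchange properties of matroid bases *)

Section Matroid.
Context (T : finType) (BB : {set {set T}}) (K : nat).
Context (exch : forall B1 B2 : {set T}, B1 \in BB -> B2 \in BB ->
  forall x, x \in B1 :\: B2 ->
  exists2 y, y \in B2 :\: B1 & y |: (B1 :\ x) \in BB).
Context (rank : forall B : {set T}, B \in BB -> #|B| = K).

Definition independent (I : {set T}) := [exists B in BB, I \subset B].

Lemma independentP (I : {set T}) :
  reflect (exists2 B, B \in BB & I \subset B) (independent I).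
Proof.
apply: (iffP existsP) => [[B /andP[]]|[B BBB IB]]; first by exists B.
by exists B; apply/andP.
Qed.

Lemma basis_independent (B : {set T}) : B \in BB -> independent B.
Proof. by move=> BBB; apply/independentP; exists B. Qed.

Lemma independentS (I J : {set T}) :
  I \subset J -> independent J -> independent I.
Proof.
move=> IJ /independentP[B BBB JB]; apply/independentP; exists B => //.
exact: subset_trans JB.
Qed.

Lemma independent_card (I : {set T}) : independent I -> #|I| <= K.
Proof. by case/independentP=> B /rank <-; exact: subset_leq_card. Qed.

Lemma independent_basis (I : {set T}) :
  independent I -> #|I| = K -> I \in BB.
Proof.
case/independentP=> B BBB IB IK; suff -> : I = B by [].
by apply/eqP; rewrite eqEcard IB IK rank /=.
Qed.

(* Among the bases containing I, one meeting B2 as much as possible lies in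
   I :|: B2, for otherwise an exchange towards B2 would improve it. *)
Lemma independent_augment (I J : {set T}) :
  independent I -> independent J -> #|I| < #|J| ->
  exists2 y, y \in J :\: I & independent (y |: I).
Proof.
case/independentP=> B0 BB0 IB0 /independentP[B2 BB2 JB2] ltIJ.
have P0 : (B0 \in BB) && (I \subset B0) by rewrite BB0.
case: (@arg_maxnP _ B0 (fun B => (B \in BB) && (I \subset B))
  (fun B => #|B :&: B2|) P0) => B1 /andP[BB1 IB1] maxB1.
have sB1 : B1 \subset I :|: B2.
  apply/subsetP => x xB1; apply: contraT; rewrite !inE negb_or => /andP[xI xB2].
  have xD : x \in B1 :\: B2 by rewrite !inE xB2.
  have [y] := exch BB1 BB2 xD; rewrite !inE => /andP[yB1 yB2] BB'.
  have IB' : I \subset y |: (B1 :\ x).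
    apply/subsetP => z zI; rewrite !inE (subsetP IB1 _ zI) andbT.
    by rewrite (contraNneq _ xI) ?orbT // => <-.
  have : #|(y |: (B1 :\ x)) :&: B2| <= #|B1 :&: B2|.
    by apply: maxB1; rewrite BB'.
  rewrite leqNgt => /negP[]; apply: proper_card; apply/properP; split.
    apply/subsetP => z; rewrite !inE => /andP[zB1 zB2].
    rewrite zB1 zB2 !andbT (_ : z != x) ?orbT //.
    by apply: contraNneq xB2 => <-.
  by exists y; rewrite !inE ?eqxx ?yB2 // (negPf yB1).
have [y /setDP[yJ yI] yB1] : exists2 y, y \in J :\: I & y \in B1.
  apply/exists_inP; apply: contraLR ltIJ; rewrite -leqNgt.
  rewrite negb_exists_in => /forall_inP nJ.
  have sub : B1 :\: I \subset B2 :\: J.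
    apply/subsetP => x /setDP[xB1 xI].
    have := subsetP sB1 _ xB1; rewrite !inE (negPf xI) /= => ->; rewrite andbT.
    by apply: contraL xB1 => xJ; apply: nJ; rewrite !inE xI.
  have := subset_leq_card sub; have := subset_leq_card IB1.
  have := subset_leq_card JB2.
  rewrite !cardsD (setIidPr IB1) (setIidPr JB2) (rank BB1) (rank BB2); lia.
exists y; first by rewrite !inE yI.
by apply/independentP; exists B1; rewrite // subUset sub1set yB1.
Qed.

(** By induction on [#|J| - #|I|], one augmentation from [J] at a time. *)
Lemma independent_extend (I J : {set T}) :
  independent I -> independent J -> #|I| <= #|J| ->
  exists2 Y : {set T}, I \subset Y &
    [/\ Y \subset I :|: J, independent Y & #|Y| = #|J|].
Proof.
move=> indI indJ; elim: {I}(#|J| - #|I|) {-2}I (erefl (#|J| - #|I|)) indI.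
  move=> I eIJ indI leIJ; exists I => //; split=> //; first exact: subsetUl.
  by apply/eqP; rewrite eqn_leq leIJ -subn_eq0 eIJ.
move=> m IHm I eIJ indI leIJ.
have ltIJ : #|I| < #|J| by lia.
have [y /setDP[yJ yI] indyI] := independent_augment indI indJ ltIJ.
have cyI : #|y |: I| = #|I|.+1 by rewrite cardsU1 yI.
have e : #|J| - #|y |: I| = m by rewrite cyI; lia.
have [|Y IY [YIJ indY cY]] := IHm _ e indyI; first by rewrite cyI.
exists Y; first by apply: subset_trans IY; exact: subsetUr.
split=> //; apply: subset_trans YIJ _.
by rewrite -setUA subUset sub1set !inE yJ orbT /=.
Qed.

(** [X] is the fundamental circuit of [h] with respect to [D], without [h] itself. If the claim
    failed, [H :\ h] would span [X], so [h] could be added to a maximal independent subset [Y] of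
    [X :|: H :\ h] containing [X]. Then [h |: X] would extend within [h |: D] to a basis [Q]
    omitting exactly one item [x] of [D]; this [x] belongs to [X], although [Q] contains [X]. *)
Lemma symmetric_exchange (H D : {set T}) (h : T) :
  H \in BB -> D \in BB -> h \in H :\: D ->
  exists2 x, x \in D :\: H & (x |: (H :\ h) \in BB) && (h |: (D :\ x) \in BB).
Proof.
move=> BH BD /setDP[hH hD].
pose X := [set x in D | h |: (D :\ x) \in BB].
have sXD : X \subset D by apply/subsetP => x; rewrite inE => /andP[].
have indX : independent X := independentS sXD (basis_independent BD).
have K0 : 0 < K by rewrite -(rank BH); apply/card_gt0P; exists h.
have indHh : independent (H :\ h).
  by apply: independentS (basis_independent BH); exact: subsetDl.
have cHh : #|H :\ h| = K.-1 by have := cardsD1 h H; rewrite hH rank //; lia.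
apply/exists_inP; apply: contraT; rewrite negb_exists_in => /forall_inP noX.
have augX (Y : {set T}) : Y \subset X :|: H :\ h -> independent Y -> #|Y| <= K.-1.
  move=> sY indY; rewrite leqNgt; apply/negP; rewrite -cHh => ltY.
  have [x /setDP[xY xHh] indx] := independent_augment indHh indY ltY.
  have xX : x \in X by have := subsetP sY _ xY; rewrite in_setU (negPf xHh) orbF.
  move: (xX); rewrite inE => /andP[xD BDx].
  have xh : x != h by apply: contraNneq hD => <-.
  have /noX : x \in D :\: H by move: xHh; rewrite !inE xD xh /= => ->.
  rewrite BDx andbT => /negP[]; apply: independent_basis => //.
  by rewrite cardsU1 xHh cHh add1n prednK.
have [Y XY [YXH indY cY]] : exists2 Y : {set T}, X \subset Y &
    [/\ Y \subset X :|: H :\ h, independent Y & #|Y| = #|H :\ h|].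
  by apply: independent_extend => //; rewrite cHh; apply: augX => //; exact: subsetUl.
have indhY : independent (h |: Y).
  have [|y /setDP[yH yY] indyY] := independent_augment indY (basis_independent BH).
    by rewrite cY cHh (rank BH) prednK.
  have [<- //|yh] := eqVneq y h.
  have : #|y |: Y| <= K.-1.
    by apply: augX => //; rewrite subUset YXH sub1set !inE yh yH orbT.
  by rewrite cardsU1 yY cY cHh add1n ltnn.
have hX : h \notin X by apply: contraNN hD; exact: (subsetP sXD).
have indhX : independent (h |: X) by apply: independentS indhY; exact: setUS.
have lehX : #|h |: X| <= #|D| by rewrite (rank BD) independent_card.
have [Q hXQ [QhD indQ cQ]] :=
  independent_extend indhX (basis_independent BD) lehX.
have BQ : Q \in BB by apply: independent_basis; rewrite // cQ (rank BD).
have hQ : h \in Q by apply: (subsetP hXQ); rewrite !inE eqxx.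
have [x xD xQ] : exists2 x, x \in D & x \notin Q.
  apply/exists_inP; apply: contraT; rewrite negb_exists_in => /forall_inP DQ.
  have : h |: D \subset Q.
    rewrite subUset sub1set hQ; apply/subsetP => x /DQ; by rewrite negbK.
  by move/subset_leq_card; rewrite cardsU1 hD (rank BD) (rank BQ) add1n ltnn.
have eQ : Q = h |: (D :\ x).
  apply/eqP; rewrite eqEcard; apply/andP; split.
    apply/subsetP => z zQ; have := subsetP QhD _ zQ; rewrite !inE.
    have -> : z != x by apply: contraNneq xQ => <-.
    case: (z == h) => //=; rewrite andbC /=.
    by case/orP => // /andP[].
  rewrite cardsU1 !inE (negPf hD) andbF /= (rank BQ) -(rank BD).
  by rewrite (cardsD1 x D) xD.
have : x \in X by rewrite inE xD -eQ.
by move=> xX; case/negP: xQ; exact: (subsetP hXQ) (setU1r h xX).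
Qed.

Context (R : realFieldType).
Local Open Scope ring_scope.

(** By induction on [#|Z|]: a symmetric exchange between the current basis [H'] and [D] yields two
    bases. The one obtained from [H'] continues the induction; the one obtained from [D] weighs at
    most as much as [D], which compares the two exchanged items. *)
Lemma max_basis_exchange (u : T -> R) (D H Z : {set T}) :
  D \in BB ->
  (forall A : {set T}, A \in BB -> \sum_(e in A) u e <= \sum_(e in D) u e) ->
  H \in BB -> Z \subset H :\: D ->
  exists phi : T -> T,
    [/\ {in Z &, injective phi}, phi @: Z \subset D :\: H,
        (H :\: Z) :|: phi @: Z \in BB & {in Z, forall z, u z <= u (phi z)}].
Proof.
move=> BD maxD BH; elim: {Z}#|Z| {-2}Z (erefl #|Z|) => [|m IHm] Z cZ ZHD.
  move/eqP: cZ; rewrite cards_eq0 => /eqP ->; exists id.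
  split; first by move=> ? ?; rewrite inE.
  - by rewrite imset0 sub0set.
  - by rewrite imset0 setU0 setD0.
  - by move=> z; rewrite inE.
have [z0 zZ] : exists z0, z0 \in Z by apply/card_gt0P; rewrite cZ.
have cZ' : #|Z :\ z0| = m by have := cardsD1 z0 Z; rewrite zZ cZ => -[].
have [|phi [inj sub BH' le]] := IHm _ cZ'.
  by apply: subset_trans ZHD; exact: subsetDl.
have /setDP[zH zD] := subsetP ZHD _ zZ.
set H' := _ :|: _ in BH'.
have zH' : z0 \in H' :\: D by rewrite !inE eqxx zH zD.
have [x /setDP[xD xH'] /andP[BH'' BD']] := symmetric_exchange BH' BD zH'.
(* The items of [H] missing from [H'] lie in [Z], hence outside [D], whereas [x] is in [D]. *)
have xH : x \notin H.
  move: xH'; rewrite !inE negb_or => /andP[]; rewrite negb_and negbK => /orP[|//].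
  by case/andP=> _ /(subsetP ZHD); rewrite inE xD.
have xphi : x \notin phi @: (Z :\ z0).
  by move: xH'; rewrite in_setU negb_or => /andP[].
exists (fun z => if z == z0 then x else phi z).
have eim : [set (if z == z0 then x else phi z) | z in Z] = x |: phi @: (Z :\ z0).
  rewrite -{1}(setD1K zZ) imsetU1 eqxx; congr (_ |: _).
  by apply: eq_in_imset => z; rewrite !inE => /andP[/negPf ->].
have phiZ z : z \in Z -> z != z0 -> phi z \in phi @: (Z :\ z0).
  by move=> ? ?; apply: imset_f; rewrite !inE; apply/andP.
split.
- move=> y z yZ zZ'; have [->|yz] := eqVneq y z0; have [->|zz] := eqVneq z z0 => //.
  + by move=> e; case/negP: xphi; rewrite e phiZ.
  + by move=> e; case/negP: xphi; rewrite -e phiZ.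
  + by apply: inj; rewrite !inE ?yz ?zz.
- by rewrite eim subUset sub1set inE xH xD.
- have -> // : H :\: Z :|: [set (if z == z0 then x else phi z) | z in Z] =
    x |: H' :\ z0.
  rewrite eim; apply/setP => y; rewrite !inE.
  have [->|yx] /= := eqVneq y x; first by rewrite orbT.
  have [->|yz] /= := eqVneq y z0; last by [].
  rewrite zZ /=; apply/imsetP => -[z zZ' ez].
  by have := subsetP sub _ (imset_f phi zZ'); rewrite -ez inE zH.
- move=> z zZ'; case: eqVneq => [->|zz]; last by apply: le; rewrite !inE zz.
  have := maxD _ BD'; rewrite big_setU1 /=; last by rewrite !inE (negPf zD) andbF.
  by rewrite (big_setD1 x xD) /= lerD2r.
Qed.

End Matroid.

(** * The regret of one round under accurate estimates *)

Section RoundRegret.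
Context (T : finType) (BB : {set {set T}}) (K : nat).
Context (exch : forall B1 B2 : {set T}, B1 \in BB -> B2 \in BB ->
  forall x, x \in B1 :\: B2 ->
  exists2 y, y \in B2 :\: B1 & y |: (B1 :\ x) \in BB).
Context (rank : forall B : {set T}, B \in BB -> #|B| = K).
Context (R : realFieldType).
Local Open Scope ring_scope.

Lemma sum_subset (f : T -> R) (A B : {set T}) :
  (forall e, 0 <= f e) -> A \subset B -> \sum_(e in A) f e <= \sum_(e in B) f e.
Proof.
by move=> f0 AB; rewrite [leRHS](big_setID A) /= (setIidPr AB) lerDl sumr_ge0.
Qed.

Lemma disjoint_subD (S H D : {set T}) : S \subset D :\: H -> [disjoint H & S].
Proof.
move=> SDH; rewrite disjoint_sym; apply: disjointWl SDH _.
by rewrite -setI_eq0 setIDAC setDIl setDv setI0.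
Qed.

Lemma sum_swap (f : T -> R) (H Z : {set T}) (phi : T -> T) :
  Z \subset H -> {in Z &, injective phi} -> [disjoint H & phi @: Z] ->
  \sum_(e in H) f e - \sum_(e in H :\: Z :|: phi @: Z) f e =
  \sum_(z in Z) (f z - f (phi z)).
Proof.
move=> ZH inj dis.
rewrite [X in _ - X](eq_bigl [predU H :\: Z & phi @: Z]) => [|x]; last by rewrite !inE.
rewrite bigU /=; last by apply: disjointWl dis; exact: subsetDl.
rewrite big_imset //= [X in X - _](big_setID Z) /= (setIidPr ZH) sumrB.
lra.
Qed.

(* g stands for the reciprocal of a gap, 0 for an infinite one, so the condition
   reads gap <= t * c. *)
Definition pay (a t g c : R) : R := if 1 <= g * (t * c) then a * c else 0.

Lemma pay_ge0 (a t g c : R) : 0 <= a -> 0 <= c -> 0 <= pay a t g c.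
Proof. by move=> a0 c0; rewrite /pay; case: ifP => // _; rewrite mulr_ge0. Qed.

(** [w] is the mean weight and [c] the confidence radius; [U] and [v] are the weights maximized by
    [D] and [B]; [g], [gs] and [g0] are the inverses of the three kinds of gaps. *)
Context (w c U v g gs g0 : T -> R) (B0 As D B : {set T}).
Context (c0 : forall e, 0 <= c e)
  (wU : forall e, w e <= U e <= w e + 2 * c e)
  (vB0 : forall e, e \in B0 -> w e <= v e <= w e + 2 * c e)
  (vNB0 : forall e, e \notin B0 -> w e - 2 * c e <= v e <= w e).
Context (BBAs : As \in BB)
  (maxAs : forall A : {set T}, A \in BB -> \sum_(e in A) w e <= \sum_(e in As) w e)
  (uniqAs : forall A : {set T}, A \in BB ->
    \sum_(e in As) w e <= \sum_(e in A) w e -> A = As).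
Context (BBD : D \in BB)
  (maxD : forall A : {set T}, A \in BB -> \sum_(e in A) U e <= \sum_(e in D) U e).
Context (BBB : B \in BB)
  (maxB : forall A : {set T}, A \in BB -> \sum_(e in A) v e <= \sum_(e in B) v e).
Context (gP : forall a e x, a \in As -> e \notin As -> w e < w a ->
    w a - w e <= x -> 1 <= g e * x)
  (gsP : forall a e x, a \in As -> e \notin As -> w e < w a ->
    w a - w e <= x -> 1 <= gs a * x)
  (g0P : forall a e x, a \notin B0 -> e \in B0 -> w e < w a ->
    w a - w e <= x -> 1 <= g0 e * x).

(** A symmetric exchange of [d] against some [x] of [As] allows two comparisons: uniqueness of the
    optimum gives [w d < w x], and maximality of [D] gives [U x <= U d]. Hence
    [w x <= U x <= U d <= w d + 2 * c d]. *)
Lemma decision_gap d : d \in D :\: As -> 1 <= g d * (2 * c d).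
Proof.
move=> dDA; have /setDP[dD dA] := dDA.
have [x /setDP[xA xD] /andP[BBx BBd]] := symmetric_exchange exch rank BBD BBAs dDA.
have lt : w d < w x.
  rewrite ltNge; apply/negP => le.
  have e : d |: As :\ x = As.
    apply: uniqAs => //; rewrite big_setU1 /=; last by rewrite !inE (negPf dA) andbF.
    by rewrite (big_setD1 x xA) /= lerD2r.
  by case/negP: dA; rewrite -e !inE eqxx.
have := maxD BBx; rewrite big_setU1 /=; last by rewrite !inE (negPf xD) andbF.
rewrite (big_setD1 d dD) /= lerD2r => leU.
by apply: (gP xA dA lt); have := wU x; have := wU d; lra.
Qed.

(** Trading all of [As :\: D] turns [As] into [D], and each trade loses at most
    [U (phi z) - w (phi z)]. *)
Lemma decision_regret :
  \sum_(e in As) w e - \sum_(e in D) w e <=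
  \sum_(e in D :\: As) pay 2 2 (g e) (c e).
Proof.
have [phi [inj sub BBH le]] :=
  max_basis_exchange exch rank BBD maxD BBAs (subxx (As :\: D)).
(* The new basis is contained in [D], and both have [K] items. *)
have eD : As :\: (As :\: D) :|: phi @: (As :\: D) = D.
  apply/eqP; rewrite eqEcard (rank BBH) (rank BBD) leqnn andbT.
  rewrite setDDr setDv set0U subUset subsetIr.
  by apply: subset_trans sub _; exact: subsetDl.
rewrite -[in X in _ - X]eD sum_swap //; last 2 first.
- exact: subsetDl.
- exact: disjoint_subD sub.
have p0 e : 0 <= pay 2 2 (g e) (c e) by rewrite pay_ge0 // c0.
apply: le_trans (sum_subset p0 sub); rewrite big_imset //=.
apply: ler_sum => z zZ; have /(subsetP sub) phiz := imset_f phi zZ.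
rewrite /pay decision_gap //; have := le _ zZ.
by have := wU z; have := wU (phi z); lra.
Qed.

(* Z is traded for J, a part of D :\: As, by phi, giving H, and psi compares H to B.
   An item h of J pays up to 2 c(h) for phi and 4 c(h) for psi, hence the constant 6;
   the gap condition holds for it with 2 c(h) by decision_gap. *)
Lemma baseline_regret :
  \sum_(e in As) w e - \sum_(e in B) w e <=
  \sum_(e in As :&: D) pay 4 4 (gs e) (c e) +
  \sum_(e in (D :|: B) :\: As) pay 6 2 (g e) (c e) +
  \sum_(e in B :&: B0) pay 4 4 (g0 e) (c e).
Proof.
pose Z := As :\: (B0 :|: B :|: D).
have ZAD : Z \subset As :\: D by apply: setDS; exact: subsetUr.
have [phi [injphi subphi BBH lephi]] := max_basis_exchange exch rank BBD maxD BBAs ZAD.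
set J := phi @: Z in subphi BBH; set H := _ :|: J in BBH.
have [psi [injpsi subpsi BBB' lepsi]] :=
  max_basis_exchange exch rank BBB maxB BBH (subxx (H :\: B)).
have eB : H :\: (H :\: B) :|: psi @: (H :\: B) = B.
  apply/eqP; rewrite eqEcard (rank BBB') (rank BBB) leqnn andbT.
  rewrite setDDr setDv set0U subUset subsetIr.
  by apply: subset_trans subpsi _; exact: subsetDl.
have sumAH : \sum_(e in As) w e - \sum_(e in H) w e =
    \sum_(z in Z) (w z - w (phi z)).
  apply: sum_swap => //; first by apply: subset_trans ZAD (subsetDl _ _).
  exact: disjoint_subD subphi.
have sumHB : \sum_(e in H) w e - \sum_(e in B) w e =
    \sum_(h in H :\: B) (w h - w (psi h)).
  rewrite -[in X in _ - X]eB; apply: sum_swap => //; first exact: subsetDl.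
  exact: disjoint_subD subpsi.
(* The three kinds of payments; [G0] and [Gs] are extended by 0 outside [B0] and [D], so that they
   can be summed over images of [psi] and over parts of [As]. *)
pose F e := pay 6 2 (g e) (c e).
pose G0 e := if e \in B0 then pay 4 4 (g0 e) (c e) else 0.
pose Gs e := if e \in D then pay 4 4 (gs e) (c e) else 0.
have F0 e : 0 <= F e by rewrite pay_ge0.
have G00 e : 0 <= G0 e by rewrite /G0; case: ifP => // _; rewrite pay_ge0.
have Gs0 e : 0 <= Gs e by rewrite /Gs; case: ifP => // _; rewrite pay_ge0.
have JD : J \subset D by apply: subset_trans subphi _; exact: subsetDl.
have JA x : x \in J -> x \notin As by move=> /(subsetP subphi) /setDP[].
(* An item of [As] that lies in [B] is not in [Z], so it was kept in [H]. *)
have psiB h : h \in H :\: B -> [/\ psi h \in B, psi h \notin H & psi h \notin As].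
  move=> hHB; have /setDP[pB pH] := subsetP subpsi _ (imset_f psi hHB).
  split=> //; apply: contra pH => pA.
  by rewrite /H /Z !inE pA pB /= orbT.
have first_le z : z \in Z -> w z - w (phi z) <= 2 * c (phi z).
  by move=> /lephi; have := wU z; have := wU (phi z); lra.
have FJ z : z \in Z -> F (phi z) = 6 * c (phi z).
  move=> zZ; rewrite /F /pay decision_gap //.
  exact: (subsetP subphi _ (imset_f phi zZ)).
(* The items of [H :\: B] outside [As] are the images under [phi] of [Z1]. For these the losses of
   both trades, by [phi] and then by [psi], are bounded together. *)
pose Z1 := [set z in Z | phi z \notin B].
have eHB : (H :\: B) :\: As = phi @: Z1.
  apply/setP => x; apply/idP/imsetP => [|[z]].
    rewrite !in_setD in_setU in_setD => /and3P[xA xB /orP[/andP[_]|xJ]].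
      by rewrite (negPf xA).
    have /imsetP[z zZ ex] := xJ; exists z => //.
    by rewrite inE zZ -ex.
  rewrite inE => /andP[zZ pzB] ->; have pzJ : phi z \in J by apply: imset_f.
  by rewrite !in_setD in_setU pzJ orbT pzB (JA _ pzJ).
have sumHBE (f : T -> R) : \sum_(h in H :\: B) f h =
    \sum_(z in Z | phi z \notin B) f (phi z) + \sum_(h in (H :\: B) :&: As) f h.
  rewrite (big_setID As) /= addrC eHB big_imset /=.
    by congr (_ + _); apply: eq_bigl => z; rewrite in_set.
  by move=> x y /setIdP[xZ _] /setIdP[yZ _]; exact: injphi.
(* Let [h = phi z] and [x = psi h]. If [x] is outside [B0], then [h] alone covers the loss. If [x]
   is in [B0], the loss is at most [4 * c h + 2 * c x], and [h] covers it when [c x <= c h].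
   Otherwise [x] pays too, unless it is no worse than the item outside [B0] that bounds its gap: [z]
   if [h] is in [B0], and [h] if not. *)
have leZ z : z \in Z -> phi z \notin B ->
    w z - w (phi z) + (w (phi z) - w (psi (phi z))) <= F (phi z) + G0 (psi (phi z)).
  move=> zZ pzB; have pzJ : phi z \in J by apply: imset_f.
  have hHB : phi z \in H :\: B by rewrite in_setD in_setU pzJ pzB orbT.
  have [xB xH xA] := psiB _ hHB.
  have zA : z \in As by move: zZ; rewrite inE => /andP[].
  have zB0 : z \notin B0 by move: zZ; rewrite !inE !negb_or => /andP[/andP[/andP[]]].
  have := FJ _ zZ; have := lepsi _ hHB; have := first_le _ zZ.
  have := G00 (psi (phi z)); rewrite /G0.
  have := c0 (phi z); have := c0 (psi (phi z)).
  move: (phi z) (psi (phi z)) {hHB xH pzJ pzB xB} => h x in xA *.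
  case: ifPn => xB0.
    have := vB0 xB0; have [hB0|hB0] := boolP (h \in B0).
      have := vB0 hB0; rewrite /pay => ??????? ->.
      have [?|ltc] := lerP (c x) (c h); first by case: ifP => _ *; nra.
      have [?|lt] := lerP (w z) (w x); first by case: ifP => _ *; nra.
      by rewrite (@g0P z) //; lra.
    have := vNB0 hB0; rewrite /pay => ??????? ->.
    have [?|ltc] := lerP (c x) (c h); first by case: ifP => _ *; nra.
    have [?|lt] := lerP (w h) (w x); first by case: ifP => _ *; nra.
    by rewrite (@g0P h) //; lra.
  have := vNB0 xB0; have [hB0|hB0] := boolP (h \in B0).
    by have := vB0 hB0; lra.
  by have := vNB0 hB0; lra.
(* Being outside [Z] and [B], the item [h] lies in [D] or in [B0]. If it is in [B0], then [v h] is
   an upper bound of its mean and only [x = psi h] may have to pay. Otherwise it is in [D]: it pays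
   itself if [x] is outside [B0], and the one of larger radius pays if [x] is in [B0]. *)
have leA h : h \in (H :\: B) :&: As ->
    w h - w (psi h) <= F (psi h) + Gs h + G0 (psi h).
  case/setIP=> hHB hA; have [xB xH xA] := psiB _ hHB.
  have hDB0 : (h \in D) || (h \in B0).
    have /setDP[hH hB] := hHB; have hJ : h \notin J by apply: contraL hA => /JA.
    move: hH; rewrite in_setU (negPf hJ) orbF /Z !inE hA (negPf hB) /=.
    by case: (h \in D); case: (h \in B0).
  have lev := lepsi _ hHB; have F0x := F0 (psi h); have G0x := G00 (psi h).
  move: (psi h) lev F0x G0x {hHB xH xB} xA => x lev F0x G0x xA.
  have Gsh := Gs0 h; have ch := c0 h; have cx := c0 x.
  have [?|lt] := lerP (w h) (w x); first lra.
  have [hB0|hB0] := boolP (h \in B0).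
    have vh := vB0 hB0; have [xB0|xB0] := boolP (x \in B0); last first.
      by have := vNB0 xB0; lra.
    have vx := vB0 xB0; have -> : F x = 6 * c x.
      by rewrite /F /pay (gP hA xA lt) //; lra.
    by lra.
  have hD : h \in D by move: hDB0; rewrite (negPf hB0) orbF.
  have vh := vNB0 hB0; have [xB0|xB0] := boolP (x \in B0); last first.
    have vx := vNB0 xB0; have -> : Gs h = 4 * c h.
      by rewrite /Gs hD /pay (gsP hA xA lt) //; lra.
    by lra.
  have vx := vB0 xB0; have [?|ltc] := lerP (c x) (c h).
    have -> : Gs h = 4 * c h.
      by rewrite /Gs hD /pay (gsP hA xA lt) //; lra.
    by lra.
  have -> : G0 x = 4 * c x by rewrite /G0 xB0 /pay (g0P hB0 xB0 lt) //; lra.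
  by lra.
have leG : \sum_(h in H :\: B) G0 (psi h) <= \sum_(e in B :&: B0) pay 4 4 (g0 e) (c e).
  rewrite -(big_imset _ injpsi) /= [leRHS](_ : _ = \sum_(e in B) G0 e).
    apply: sum_subset => //; apply: subset_trans subpsi _; exact: subsetDl.
  rewrite [RHS](big_setID B0) /= [X in _ + X]big1 ?addr0 => [|e /setDP[_]].
    by apply: eq_bigr => e /setIP[_ eB0]; rewrite /G0 eB0.
  by rewrite /G0 => /negPf ->.
have leGs : \sum_(h in (H :\: B) :&: As) Gs h <=
    \sum_(e in As :&: D) pay 4 4 (gs e) (c e).
  rewrite [leRHS](_ : _ = \sum_(e in As) Gs e).
    by apply: sum_subset => //; exact: subsetIr.
  rewrite [RHS](big_setID D) /= [X in _ + X]big1 ?addr0 => [|e /setDP[_]].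
    by apply: eq_bigr => e /setIP[_ eD]; rewrite /Gs eD.
  by rewrite /Gs => /negPf ->.
(* No item is charged twice through [F]: [J] lies in [H], and the image [Q] under [psi] avoids
   [H]. *)
have leF : \sum_(z in Z) F (phi z) + \sum_(h in (H :\: B) :&: As) F (psi h) <=
    \sum_(e in (D :|: B) :\: As) F e.
  pose Q := psi @: ((H :\: B) :&: As).
  have QBH : Q \subset (B :\: H) :\: As.
    apply/subsetP => _ /imsetP[h /setIP[hHB _] ->].
    by have [? ? ?] := psiB _ hHB; rewrite !in_setD; apply/and3P.
  rewrite -(big_imset _ injphi) /= -/J.
  have injpsi' : {in (H :\: B) :&: As &, injective psi}.
    by move=> x y /setIP[xHB _] /setIP[yHB _]; exact: injpsi.
  rewrite -(big_imset _ injpsi') /= -/Q.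
  have dJQ : [disjoint J & Q].
    rewrite disjoint_subset; apply/subsetP => x xJ; rewrite inE.
    apply: contraTN xJ => /(subsetP QBH); rewrite !in_setD in_setU negb_or.
    by case/and3P => _ /andP[].
  rewrite -bigU //= (eq_bigl (mem (J :|: Q))) => [|x]; last by rewrite !inE.
  apply: sum_subset => //; rewrite subUset; apply/andP; split.
    apply/subsetP => x xJ; rewrite in_setD in_setU (subsetP JD _ xJ).
    by rewrite (JA _ xJ).
  apply: subset_trans QBH _; apply: setSD; apply: subset_trans (subsetDl _ _) _.
  exact: subsetUr.
rewrite -(subrKA (\sum_(e in H) w e)) sumAH sumHB.
(* An item [z] with [phi z] in [B] undergoes the first trade only. *)
have split1 : \sum_(z in Z) (w z - w (phi z)) =
    \sum_(z in Z | phi z \notin B) (w z - w (phi z)) +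
    \sum_(z in Z | phi z \in B) (w z - w (phi z)).
  rewrite (bigID (fun z => phi z \in B)) /= addrC //.
have split2 : \sum_(z in Z) F (phi z) =
    \sum_(z in Z | phi z \notin B) F (phi z) +
    \sum_(z in Z | phi z \in B) F (phi z).
  rewrite (bigID (fun z => phi z \in B)) /= addrC //.
have le1 : \sum_(z in Z | phi z \in B) (w z - w (phi z)) <=
    \sum_(z in Z | phi z \in B) F (phi z).
  apply: ler_sum => z /andP[zZ _]; rewrite FJ //.
  by have := first_le _ zZ; have := c0 (phi z); lra.
have le2 : \sum_(z in Z | phi z \notin B) (w z - w (phi z)) +
    \sum_(z in Z | phi z \notin B) (w (phi z) - w (psi (phi z))) <=
    \sum_(z in Z | phi z \notin B) F (phi z) +
    \sum_(z in Z | phi z \notin B) G0 (psi (phi z)).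
  by rewrite -!big_split /=; apply: ler_sum => z /andP[? ?]; exact: leZ.
have le3 : \sum_(h in (H :\: B) :&: As) (w h - w (psi h)) <=
    \sum_(h in (H :\: B) :&: As) F (psi h) +
    \sum_(h in (H :\: B) :&: As) Gs h +
    \sum_(h in (H :\: B) :&: As) G0 (psi h).
  by rewrite -!big_split /=; apply: ler_sum => h hHB; exact: leA.
move: leF leG; rewrite split1 split2 !sumHBE; lra.
Qed.

End RoundRegret.

(** * Summation over the rounds *)

Local Open Scope ring_scope.

(* The payments are made while [sqrt (T r) <= g * t * sqrt ell], and each of them is
   at most twice the increment of [a * sqrt ell * sqrt (T r - 1)]. *)
Lemma sum_pay_sqrt (R : rcfType) (a t g ell : R) (T : nat -> nat) (N : nat)
    (Q : pred nat) :
  0 <= a -> 0 <= t -> 0 <= g -> 0 <= ell -> (0 < T 0)%N ->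
  (forall r, (r < N)%N -> (T r + Q r <= T r.+1)%N) ->
  \sum_(0 <= r < N | Q r) pay a t g (Num.sqrt (ell / (T r)%:R)) <=
  2 * a * t * g * ell.
Proof.
move=> a0 t0 g0 ell0 T0 incT.
set s := Num.sqrt ell; pose y := g * (t * s).
have s0 : 0 <= s by exact: sqrtr_ge0.
have y0 : 0 <= y by rewrite !mulr_ge0.
have Tgt0 m : (m <= N)%N -> (0 < T m)%N.
  elim: m => // m IHm mN; apply: leq_trans (incT _ mN).
  by rewrite addn_gt0 IHm // ltnW.
(* The minimum covers both regimes: growth with the number of observations, and no payment once
   [sqrt (T m)] exceeds [y]. *)
suff claim m : (m <= N)%N ->
    \sum_(0 <= r < m | Q r) pay a t g (Num.sqrt (ell / (T r)%:R)) <=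
    2 * a * s * Num.min (Num.sqrt (T m).-1%:R) y.
  apply: le_trans (claim N (leqnn N)) _.
  have e : 2 * a * t * g * ell = 2 * a * s * y.
    by rewrite /y -(sqr_sqrtr ell0) -/s; ring.
  by rewrite e ler_wpM2l ?mulr_ge0 // ge_min lexx orbT.
elim: m => [_|m IHm mN].
  by rewrite big_geq // !mulr_ge0 // le_min sqrtr_ge0.
rewrite big_mkcond big_nat_recr //= -big_mkcond /=.
have := IHm (ltnW mN); have inc := incT _ mN; have Tm0 := Tgt0 _ (ltnW mN).
set S := \sum_(_ <= _ < _ | _) _ => leS.
pose p : R := Num.sqrt (T m)%:R; pose q : R := Num.sqrt (T m).-1%:R.
pose q' : R := Num.sqrt (T m.+1).-1%:R.
have p0 : 0 < p by rewrite sqrtr_gt0 ltr0n.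
have q0 : 0 <= q by exact: sqrtr_ge0.
have pq : p ^+ 2 = q ^+ 2 + 1.
  by rewrite !sqr_sqrtr ?ler0n // natr1 prednK.
have Tmm : (T m <= T m.+1)%N := leq_trans (leq_addr _ _) inc.
have qq' : q <= q' by rewrite ler_wsqrtr // ler_nat -!subn1 leq_sub2r.
have mono : 2 * a * s * Num.min q y <= 2 * a * s * Num.min q' y.
  by rewrite ler_wpM2l ?mulr_ge0 // le_min !ge_min qq' lexx orbT.
rewrite -/q in leS; rewrite -/q'.
case Qm: (Q m) => /=; last by rewrite addr0; apply: le_trans mono.
rewrite sqrtrM // sqrtrV ?ler0n // -/s -/p /pay; case: ifPn => [le1|_]; last first.
  by rewrite addr0; apply: le_trans mono.
have py : p <= y.
  by rewrite /y; move: le1; rewrite !mulrA ler_pdivlMr // mul1r.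
have qp : q <= p by rewrite ler_wsqrtr // ler_nat leq_pred.
have pq' : p <= q'.
  by rewrite ler_wsqrtr // ler_nat; move: inc; rewrite Qm addn1; case: (T m.+1).
have minq : Num.min q y = q by apply/min_idPl; exact: le_trans qp py.
have minq' : p <= Num.min q' y by rewrite le_min pq' py.
(* This is [(p - q) * (p + q) = 1] together with [q <= p]. *)
have step : p^-1 <= 2 * (p - q).
  by rewrite -[p^-1]mul1r ler_pdivrMr //; nra.
rewrite minq in leS.
have as0 : 0 <= a * s by rewrite mulr_ge0.
have : a * s * p^-1 <= a * s * (2 * (p - q)) by rewrite ler_wpM2l.
have : a * s * p <= a * s * Num.min q' y by rewrite ler_wpM2l.
move: leS; rewrite (_ : a * (s / p) = a * s / p); last by rewrite mulrA.
set z := Num.min q' y; lra.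
Qed.

From mathcomp Require Import all_classical all_reals all_analysis.
From mathcomp Require Import measurable_realfun.

Import numFieldNormedType.Exports.

Local Open Scope classical_set_scope.
Local Open Scope ring_scope.

(** * Hoeffding's inequality *)

Lemma is_derive_ge0_le (R : realType) (f f' : R -> R) (a b : R) :
  (forall x : R, is_derive x 1 f (f' x)) -> a <= b ->
  (forall x, a <= x <= b -> 0 <= f' x) -> f a <= f b.
Proof.
move=> df ab f'0; apply: (@ger0_derive1_ndecr _ f a b) => //.
- move=> x xab; rewrite derive1E derive_val f'0 //.
  by move: xab; rewrite in_itv /= => /andP[/ltW -> /ltW ->].
- apply: continuous_subspaceT => x; apply: differentiable_continuous.
  exact/derivable1_diffP.
Qed.

(* With [phi x = exp (m x + x ^ 2 / 8) - (1 - m + m exp x)] one has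
   [phi' x = exp x * psi x], and [psi' x] is [(m + x / 4 - 1 / 2) ^ 2] times an
   exponential; both [phi] and [psi] vanish at 0. *)
Lemma hoeffding_bernoulli (R : realType) (m x : R) :
  1 - m + m * expR x <= expR (m * x + x ^+ 2 / 8).
Proof.
pose psi (y : R) := (m + y / 4) * expR (y * (m - 1) + y ^+ 2 / 8) - m.
pose phi (y : R) := expR (m * y + y ^+ 2 / 8) - (1 - m + m * expR y).
have dexp (p : R -> R) (p' y : R) : is_derive y 1 p p' ->
    is_derive y 1 (fun z => expR (p z)) (expR (p y) * p').
  by move=> dp; apply: (is_derive1_comp (f := expR)).
have dpsi (y : R) : is_derive y 1 psi
    (expR (y * (m - 1) + y ^+ 2 / 8) * (m + y / 4 - 1 / 2) ^+ 2).
  have d1 : is_derive y 1 (fun z => expR (z * (m - 1) + z ^+ 2 / 8))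
      (expR (y * (m - 1) + y ^+ 2 / 8) * (m - 1 + y / 4)).
    by apply: dexp; apply: is_derive_eq; rewrite /GRing.scale /=; field.
  by apply: is_derive_eq; rewrite /GRing.scale /=; field.
have dphi (y : R) : is_derive y 1 phi (expR y * psi y).
  have d1 : is_derive y 1 (fun z => expR (m * z + z ^+ 2 / 8))
      (expR (m * y + y ^+ 2 / 8) * (m + y / 4)).
    by apply: dexp; apply: is_derive_eq; rewrite /GRing.scale /=; field.
  apply: is_derive_eq; rewrite /GRing.scale /= /psi.
  rewrite (_ : m * y + _ = y + (y * (m - 1) + y ^+ 2 / 8)); last by ring.
  by rewrite expRD; ring.
have psi0 : psi 0 = 0 by rewrite /psi !(mul0r, expr0n, addr0) expR0; ring.
have phi0 : phi 0 = 0 by rewrite /phi !(mulr0, mul0r, expr0n, addr0) expR0; ring.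
suff : 0 <= phi x by rewrite /phi subr_ge0.
have psi'0 y : 0 <= expR (y * (m - 1) + y ^+ 2 / 8) * (m + y / 4 - 1 / 2) ^+ 2.
  by rewrite mulr_ge0 ?expR_ge0 // sqr_ge0.
have [x0|/ltW x0] := leP 0 x.
  rewrite -phi0; apply: is_derive_ge0_le dphi x0 _ => y /andP[y0 _].
  rewrite mulr_ge0 ?expR_ge0 // -psi0.
  exact: is_derive_ge0_le dpsi y0 _.
rewrite -phi0 -lerN2.
apply: (@is_derive_ge0_le _ (- phi) (fun y => - (expR y * psi y)) x 0) => // y.
move=> /andP[_ y0]; rewrite -mulrN mulr_ge0 ?expR_ge0 // oppr_ge0 -psi0.
exact: is_derive_ge0_le dpsi y0 _.
Qed.

(** Weights lie in [0,1] only almost surely. Their clamped versions agree with them there and are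
    bounded everywhere, so that their integrals are finite. *)
Definition clamp (R : realType) (x : R) : R := Num.max 0 (Num.min x 1).

Lemma clamp_itv (R : realType) (x : R) : 0 <= clamp x <= 1.
Proof. by rewrite /clamp le_max lexx ge_max ler01 ge_min lexx orbT. Qed.

Lemma clamp_id (R : realType) (x : R) : 0 <= x <= 1 -> clamp x = x.
Proof. by case/andP=> x0 x1; rewrite /clamp (min_idPl x1) (max_idPr x0). Qed.

Lemma measurable_clamp (R : realType) : measurable_fun setT (@clamp R).
Proof. by apply: measurable_maxr => //; exact: measurable_minr. Qed.

Lemma expR_chord (R : realType) (l x : R) : 0 <= x <= 1 ->
  expR (l * x) <= 1 - x + x * expR l.
Proof.
case/andP=> x0 x1; have := convex_expR (Itv01 x0 x1) (l : R^o) (0 : R^o).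
rewrite !convRE /= !mulr0 expR0 mulr1 addr0 mulrC => /le_trans; apply.
by rewrite addrC.
Qed.

(** * Mean and exponential moment of one weight under the law of the bandit *)

Section Law.
Context (R : realType) (L K : nat) (b : bandit R L K).

Let mtnth (e : 'I_L) : measurable_fun setT
  (fun w : L.-tuple (measurableTypeR R) => tnth w e : measurableTypeR R).
Proof. exact: measurable_tnth. Qed.

Lemma ae_law_cube : {ae law b, forall w, forall e, 0 <= tnth w e <= 1}.
Proof.
have mC : measurable [set w : L.-tuple (measurableTypeR R) |
    forall e, 0 <= tnth w e <= 1].
  rewrite [X in measurable X](_ : _ = \bigcap_(e : 'I_L)
      ((fun w : L.-tuple (measurableTypeR R) => tnth w e : measurableTypeR R)
        @^-1` `[0, 1])).
    apply: fin_bigcap_measurable => [|e _]; first exact: finite_finset.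
    by rewrite -[X in measurable X]setTI; exact: mtnth.
  apply/seteqP; split => w /= wC e; first by move=> _ /=; rewrite in_itv /=.
  by have := wC e I; rewrite /= in_itv.
exists (~` [set w | forall e, 0 <= tnth w e <= 1]); split => //.
  exact: measurableC.
by rewrite probability_setC // law_cube subee.
Qed.

(** [wbar] takes [fine] of an expectation, which would give 0 for an infinite one; boundedness of
    the weights makes the expectation finite. *)
Lemma wbarE (e : 'I_L) : (\int[law b]_w (clamp (tnth w e))%:E = (wbar b e)%:E)%E.
Proof.
have mc : measurable_fun setT
    (fun w : L.-tuple (measurableTypeR R) => clamp (tnth w e)).
  by apply: (measurableT_comp (@measurable_clamp R)); exact: mtnth.
have mt : measurable_fun setT (fun w : L.-tuple (measurableTypeR R) => tnth w e).
  exact: mtnth.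
have aeE : ae_eq (law b) setT (fun w => (clamp (tnth w e))%:E)
    (fun w => (tnth w e)%:E).
  have := ae_law_cube; apply: (@filterS _ _ (ae_filter_ringOfSetsType (law b))) => w wC _.
  by rewrite clamp_id.
have E : (\int[law b]_w (clamp (tnth w e))%:E = \int[law b]_w (tnth w e)%:E)%E.
  by apply: ae_eq_integral => //; exact/measurable_EFinP.
rewrite /wbar unlock -E.
rewrite fineK // ge0_fin_numE.
  apply: (@le_lt_trans _ _ (\int[law b]_w (cst 1%:E w))%E).
    apply: ge0_le_integral => //.
    - by move=> w _; rewrite lee_fin; case/andP: (clamp_itv (tnth w e)).
    - exact/measurable_EFinP.
    - by move=> w _; rewrite lee_fin; case/andP: (clamp_itv (tnth w e)).
  by rewrite integral_cst //= probability_setT mule1 ltry.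
by apply: integral_ge0 => w _; rewrite lee_fin; case/andP: (clamp_itv (tnth w e)).
Qed.

Lemma wbar_itv (e : 'I_L) : 0 <= wbar b e <= 1.
Proof.
have mc : measurable_fun setT
    (fun w : L.-tuple (measurableTypeR R) => clamp (tnth w e)).
  by apply: (measurableT_comp (@measurable_clamp R)); exact: mtnth.
rewrite -!lee_fin -wbarE; apply/andP; split.
  by apply: integral_ge0 => w _; rewrite lee_fin; case/andP: (clamp_itv (tnth w e)).
rewrite [leRHS](_ : _ = \int[law b]_w (cst 1%:E w))%E; last first.
  by rewrite integral_cst //= probability_setT mule1.
apply: ge0_le_integral => //.
- by move=> w _; rewrite lee_fin; case/andP: (clamp_itv (tnth w e)).
- exact/measurable_EFinP.
- by move=> w _; rewrite lee_fin; case/andP: (clamp_itv (tnth w e)).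
Qed.

(** Convexity bounds [expR (l * x)] on [0,1] by its chord, which is affine in [x]. The integral of
    the chord depends only on the mean: it is the moment generating function of a Bernoulli law of
    mean [wbar b e], to which [hoeffding_bernoulli] applies. *)
Lemma hoeffding_law (e : 'I_L) (l : R) :
  (\int[law b]_w (expR (l * (tnth w e - wbar b e) - l ^+ 2 / 8))%:E <= 1)%E.
Proof.
have mt : measurable_fun setT (fun w : L.-tuple (measurableTypeR R) => tnth w e).
  exact: mtnth.
have mc : measurable_fun setT
    (fun w : L.-tuple (measurableTypeR R) => clamp (tnth w e)).
  exact: (measurableT_comp (@measurable_clamp R)).
set m := wbar b e; set k := - (l * m) - l ^+ 2 / 8.
have me : measurable_fun setT (fun w : L.-tuple (measurableTypeR R) =>
    expR (l * (tnth w e - m) - l ^+ 2 / 8)).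
  apply: (measurableT_comp (@measurable_expR R)).
  by apply: measurable_funB => //; apply: measurable_funM => //; apply: measurable_funB.
have c01 (w : L.-tuple (measurableTypeR R)) : 0 <= clamp (tnth w e) <= 1.
  exact: clamp_itv.
have g0 (w : L.-tuple (measurableTypeR R)) :
    0 <= 1 - clamp (tnth w e) + clamp (tnth w e) * expR l.
  by have := c01 w; have := expR_gt0 l; nra.
have mg : measurable_fun setT (fun w : L.-tuple (measurableTypeR R) =>
    1 - clamp (tnth w e) + clamp (tnth w e) * expR l).
  by apply: measurable_funD; [exact: measurable_funB | exact: measurable_funM].
apply: (@le_trans _ _ (\int[law b]_w ((expR k)%:E *
    (1 - clamp (tnth w e) + clamp (tnth w e) * expR l)%:E))%E).
  apply: ae_ge0_le_integral => //.
  - exact/measurable_EFinP.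
  - by move=> w _; rewrite -EFinM lee_fin mulr_ge0 // expR_ge0.
  - by apply/measurable_EFinP; apply: measurable_funM => //; exact: measurable_cst.
  - have := ae_law_cube.
    apply: (@filterS _ _ (ae_filter_ringOfSetsType (law b))) => w wC _.
    rewrite -EFinM lee_fin clamp_id //.
    rewrite (_ : _ - _ = k + l * tnth w e); last by rewrite /k; ring.
    by rewrite expRD ler_wpM2l ?expR_ge0 // expR_chord.
rewrite ge0_integralZl //; last 2 first.
- exact/measurable_EFinP.
- by move=> w _; rewrite lee_fin.
have c0 (w : L.-tuple (measurableTypeR R)) : 0 <= clamp (tnth w e).
  by case/andP: (c01 w).
have c1 (w : L.-tuple (measurableTypeR R)) : 0 <= 1 - clamp (tnth w e).
  by rewrite subr_ge0; case/andP: (c01 w).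
have E1 : (\int[law b]_w (1 - clamp (tnth w e))%:E = (1 - m)%:E)%E.
  have E : (\int[law b]_w (1 - clamp (tnth w e))%:E + m%:E = 1)%E.
    rewrite -wbarE -ge0_integralD //.
    - under eq_integral => w _ do rewrite -EFinD subrK.
      by rewrite integral_cst //= probability_setT mule1.
    - by move=> w _; rewrite lee_fin.
    - by apply/measurable_EFinP; exact: measurable_funB.
    - by move=> w _; rewrite lee_fin.
    - exact/measurable_EFinP.
  by rewrite EFinB -E addeK.
under eq_integral => w _ do rewrite EFinD EFinM.
rewrite ge0_integralD //; last 4 first.
- by move=> w _; rewrite lee_fin.
- by apply/measurable_EFinP; exact: measurable_funB.
- by move=> w _; rewrite -EFinM lee_fin mulr_ge0 // expR_ge0.
- by apply/measurable_EFinP; exact: measurable_funM.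
rewrite ge0_integralZr //; last 2 first.
- exact/measurable_EFinP.
- by move=> w _; rewrite lee_fin.
rewrite E1 wbarE -/m -EFinM lee_fin.
apply: (@le_trans _ _ (expR k * expR (m * l + l ^+ 2 / 8))).
  by rewrite ler_wpM2l ?expR_ge0 // hoeffding_bernoulli.
by rewrite -expRD /k (_ : _ + _ = 0) ?expR0 //; ring.
Qed.

End Law.

(** * Exponential supermartingales and expected regret *)

Section Independence.
Local Open Scope ereal_scope.
Context (R : realType) (d d' : measure_display) (Omega : measurableType d)
  (T : measurableType d') (Pr : probability Omega R) (mu : probability T R)
  (F : set (set Omega)) (X : Omega -> T).
Context (sF : sigma_algebra setT F) (mF : F `<=` measurable)
  (mX : measurable_fun setT X).
Context (indep : forall S V, F S -> measurable V ->
  Pr (S `&` X @^-1` V) = Pr S * mu V).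

Local Notation OF := (g_sigma_algebraType F).

(* The law of (id, X), the target of id carrying the sigma-algebra F, is the product of
   its marginals; Tonelli's theorem concludes. *)
Lemma ge0_integral_indep (G : OF -> \bar R) (f : T -> \bar R) :
  measurable_fun setT G -> (forall om, 0 <= G om) ->
  measurable_fun setT f -> (forall x, 0 <= f x) ->
  \int[Pr]_om (G om * f (X om)) = (\int[Pr]_om G om) * \int[mu]_x f x.
Proof.
move=> mG G0 mf f0.
pose idF : Omega -> OF := id.
have midF : measurable_fun setT idF.
  by move=> _ S; rewrite measurable_g_measurableTypeE // setTI => FS; exact: mF.
pose j om := (idF om, X om).
have mj : measurable_fun setT j by exact: measurable_fun_pair.
pose idM : {mfun Omega >-> OF} := mfun_Sub (mem_set midF).
pose jM : {mfun Omega >-> (OF * T)%type} := mfun_Sub (mem_set mj).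
pose m1 := distribution Pr idM.
pose m' := distribution Pr jM.
have E (S : set (OF * T)) : measurable S -> (m1 \x mu) S = m' S.
  apply: product_measure_unique => A B mA mB.
  rewrite /m' /m1 /distribution /pushforward /= -indep //.
  by move: mA; rewrite measurable_g_measurableTypeE.
pose h (z : OF * T) : \bar R := G z.1 * f z.2.
have mh : measurable_fun setT h.
  apply: emeasurable_funM; first exact: measurableT_comp mG _.
  exact: measurableT_comp mf _.
have h0 z : 0 <= h z by rewrite mule_ge0.
transitivity (\int[m']_z h z).
  by rewrite ge0_integral_pushforward.
rewrite (eq_measure_integral (m1 \x mu)) => [|S mS _]; last exact/esym/E.
rewrite fubini_tonelli1 //.
under eq_integral => x _ do rewrite /fubini_F /h /= ge0_integralZl //.
rewrite ge0_integralZr //; last exact: integral_ge0.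
by rewrite ge0_integral_pushforward.
Qed.

End Independence.

(** * Adapted variables and the exponential supermartingale of an item *)

Section Adapted.
Context (R : realType) (L K : nat) (b : bandit R L K) (d : measure_display)
  (Omega : measurableType d) (Pr : probability Omega R)
  (env : environment b Pr).

Local Notation Past t := (g_sigma_algebraType (past env t)).

Lemma pastE t (S : set (Past t)) : measurable S = past env t S.
Proof. by rewrite (measurable_g_measurableTypeE (past_sigma_algebra env t)). Qed.

Lemma past_le s t : (s <= t)%N -> past env s `<=` past env t.
Proof.
elim: t => [|t IHt]; first by rewrite leqn0 => /eqP ->.
rewrite leq_eqVlt => /predU1P[-> //|]; rewrite ltnS => /IHt sub S /sub.
exact: past_nondecreasing.
Qed.

(** The events of [past env t] are made the measurable sets of a copy of [Omega], so that the
    general lemmas on measurable functions apply. *)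
Definition adapted t d' (T : measurableType d') (f : Omega -> T) :=
  measurable_fun setT (f : Past t -> T).

Lemma adapted_le s t d' (T : measurableType d') (f : Omega -> T) :
  (s <= t)%N -> adapted s f -> adapted t f.
Proof.
move=> st mf _ Y mY; rewrite pastE; apply: (past_le st); rewrite -pastE.
exact: mf.
Qed.

Lemma adapted_measurable t d' (T : measurableType d') (f : Omega -> T) :
  adapted t f -> measurable_fun setT f.
Proof.
move=> mf _ Y mY; apply: (@past_measurable _ _ _ _ _ _ _ env t); rewrite -pastE.
exact: mf.
Qed.

Lemma adapted_draw t : adapted t (draw env t).
Proof. by move=> _ V mV; rewrite pastE setTI; exact: draw_past. Qed.

Lemma adapted_draw_item t (e : 'I_L) :
  adapted t (fun om => tnth (draw env t om) e : measurableTypeR R).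
Proof.
have mt : measurable_fun setT
    (fun w : L.-tuple (measurableTypeR R) => tnth w e : measurableTypeR R).
  exact: measurable_tnth.
by rewrite /adapted; apply: (measurableT_comp mt); exact: adapted_draw.
Qed.

Lemma draw_indep t S V : past env t S -> measurable V ->
  (Pr (S `&` draw env t.+1 @^-1` V) = Pr S * law b V)%E.
Proof. by move=> pS mV; rewrite draw_fresh // -(draw_law env t.+1 mV). Qed.

Lemma ge0_integral_draw t (G : Omega -> \bar R)
    (f : L.-tuple (measurableTypeR R) -> \bar R) :
  adapted t G -> (forall om, 0 <= G om)%E ->
  measurable_fun setT f -> (forall x, 0 <= f x)%E ->
  (\int[Pr]_om (G om * f (draw env t.+1 om)) =
   (\int[Pr]_om G om) * \int[law b]_x f x)%E.
Proof.
move=> mG G0 mf f0; apply: (ge0_integral_indep (past_sigma_algebra env t)) => //.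
- exact: past_measurable.
- by move=> S V; exact: draw_indep.
Qed.

Lemma ge0_integral_draw0 t (f : L.-tuple (measurableTypeR R) -> \bar R) :
  measurable_fun setT f -> (forall x, 0 <= f x)%E ->
  (\int[Pr]_om f (draw env t om) = \int[law b]_x f x)%E.
Proof.
move=> mf f0; transitivity (\int[distribution Pr (draw env t)]_x f x)%E.
  by rewrite ge0_integral_pushforward.
by apply: eq_measure_integral => V mV _; exact: draw_law.
Qed.

Context (A : nat -> Omega -> {set 'I_L}) (n : nat).
Context (past_A : forall t S, (t < n)%N -> past env t (A t.+1 @^-1` [set S])).

Lemma adapted_mem t (e : 'I_L) : (t < n)%N ->
  adapted t (fun om => e \in A t.+1 om).
Proof.
move=> tn; apply: (@measurable_fun_bool _ _ _ _ true); rewrite setTI.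
rewrite [X in measurable X](_ : _ =
    \bigcup_(S in [set S : {set 'I_L} | e \in S]) A t.+1 @^-1` [set S]); last first.
  apply/seteqP; split => om /=; first by move=> eA; exists (A t.+1 om).
  by case=> S /= eS ->.
apply: fin_bigcup_measurable => [|S _]; first exact: finite_finset.
by rewrite pastE; exact: past_A.
Qed.

(** The constant 8 is that of Hoeffding's inequality for variables in [0,1]. The initial observation
    is included, so the process at time 0 already consists of one exponential factor. *)
Definition expmart (e : 'I_L) (l : R) t om : R :=
  expR (l * \sum_(x <- observed env A t om e) (x - wbar b e) -
        l ^+ 2 / 8 * (nobs env A t om e)%:R).

Lemma observedS t om e : observed env A t.+1 om e =
  observed env A t om e ++
  (if e \in A t.+1 om then [:: tnth (draw env t.+1 om) e] else [::]).
Proof.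
have iotaS : iota 1 t.+1 = iota 1 t ++ [:: t.+1].
  by rewrite -[in LHS](addn1 t) iotaD add1n.
by rewrite /observed iotaS filter_cat map_cat /=; case: ifP.
Qed.

Lemma nobsS t om e :
  nobs env A t.+1 om e = (nobs env A t om e + (e \in A t.+1 om))%N.
Proof. by rewrite /nobs observedS size_cat; case: ifP. Qed.

Lemma expmartS e l t om : expmart e l t.+1 om =
  if e \in A t.+1 om then expmart e l t om *
    expR (l * (tnth (draw env t.+1 om) e - wbar b e) - l ^+ 2 / 8)
  else expmart e l t om.
Proof.
rewrite /expmart nobsS observedS big_cat /=; case: ifP => _.
  by rewrite big_seq1 natrD /= -expRD; congr expR; field.
by rewrite big_nil addr0 addn0.
Qed.

Lemma expmart0 e l om : expmart e l 0 om =
  expR (l * (tnth (draw env 0 om) e - wbar b e) - l ^+ 2 / 8).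
Proof. by rewrite /expmart /nobs /observed /= big_seq1 mulr1. Qed.

Let measurable_exp_item e l :
  measurable_fun setT (fun w : L.-tuple (measurableTypeR R) =>
    expR (l * (tnth w e - wbar b e) - l ^+ 2 / 8)).
Proof.
have mt : measurable_fun setT (fun w : L.-tuple (measurableTypeR R) => tnth w e).
  exact: measurable_tnth.
apply: (measurableT_comp (@measurable_expR R)).
by apply: measurable_funB => //; apply: measurable_funM => //; apply: measurable_funB.
Qed.

Lemma adapted_expmart e l t : (t <= n)%N -> adapted t (expmart e l t).
Proof.
have mX s : adapted s (fun om =>
    expR (l * (tnth (draw env s om) e - wbar b e) - l ^+ 2 / 8)).
  rewrite /adapted; apply: (measurableT_comp (measurable_exp_item e l)).
  exact: adapted_draw.
elim: t => [_|t IHt tn].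
  rewrite (_ : expmart e l 0 = (fun om =>
    expR (l * (tnth (draw env 0 om) e - wbar b e) - l ^+ 2 / 8))) //.
  by apply/funext => om; exact: expmart0.
have -> : expmart e l t.+1 = (fun om =>
  if e \in A t.+1 om then expmart e l t om *
    expR (l * (tnth (draw env t.+1 om) e - wbar b e) - l ^+ 2 / 8)
  else expmart e l t om) by apply/funext => om; exact: expmartS.
have mM : adapted t.+1 (expmart e l t) := adapted_le (leqnSn t) (IHt (ltnW tn)).
have mA := adapted_le (leqnSn t) (adapted_mem e tn).
have mY := mX t.+1; rewrite /adapted in mM mA mY *.
exact: measurable_fun_ifT mA (measurable_funM mM mY) mM.
Qed.

(** Whether [e] is observed at step [t.+1] is known at time [t]. On that event ([G1]) the new factor
    is independent of the past and has integral at most 1; off it ([G2]) the process does not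
    change. *)
Lemma integral_expmart e l t : (t <= n)%N ->
  (\int[Pr]_om (expmart e l t om)%:E <= 1)%E.
Proof.
elim: t => [_|t IHt tn].
  under eq_integral => om _ do rewrite expmart0.
  rewrite (ge0_integral_draw0 0 (f := fun w =>
    (expR (l * (tnth w e - wbar b e) - l ^+ 2 / 8))%:E)).
  - exact: hoeffding_law.
  - exact/measurable_EFinP.
  - by move=> w; rewrite lee_fin expR_ge0.
have M0 om : 0 <= expmart e l t om by exact: expR_ge0.
have mM := adapted_expmart e l (ltnW tn); have mA := adapted_mem e tn.
pose G1 om := (if e \in A t.+1 om then expmart e l t om else 0)%:E.
pose G2 om := (if e \in A t.+1 om then 0 else expmart e l t om)%:E.
pose f (w : L.-tuple (measurableTypeR R)) :=
  (expR (l * (tnth w e - wbar b e) - l ^+ 2 / 8))%:E.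
have f0 w : (0 <= f w)%E by rewrite lee_fin expR_ge0.
have mf : measurable_fun setT f by exact/measurable_EFinP.
have G10 om : (0 <= G1 om)%E by rewrite /G1; case: ifP; rewrite lee_fin.
have G20 om : (0 <= G2 om)%E by rewrite /G2; case: ifP; rewrite lee_fin.
have mG1 : adapted t G1 by apply/measurable_EFinP; exact: measurable_fun_ifT.
have mG2 : adapted t G2 by apply/measurable_EFinP; exact: measurable_fun_ifT.
have mG1' := adapted_measurable mG1; have mG2' := adapted_measurable mG2.
have mfX : measurable_fun setT (fun om => f (draw env t.+1 om)).
  exact: measurableT_comp mf _.
rewrite (eq_integral (fun om => G1 om * f (draw env t.+1 om) + G2 om)%E); last first.
  move=> om _; rewrite expmartS /G1 /G2 /f; case: ifP => _.
    by rewrite adde0 EFinM.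
  by rewrite mul0e add0e.
rewrite ge0_integralD //; last 2 first.
- by move=> om _; rewrite mule_ge0.
- exact: emeasurable_funM.
rewrite ge0_integral_draw //.
apply: le_trans (IHt (ltnW tn)).
rewrite [leRHS](eq_integral (fun om => G1 om + G2 om)%E); last first.
  by move=> om _; rewrite /G1 /G2; case: ifP; rewrite ?adde0 ?add0e.
rewrite ge0_integralD // leeD2r // -[leRHS]mule1 lee_wpmul2l ?integral_ge0 //.
exact: hoeffding_law.
Qed.

End Adapted.

(** * Replacing the draws by their means in the expected regret *)

Section MeanRegret.
Context (R : realType) (L K : nat) (b : bandit R L K) (d : measure_display)
  (Omega : measurableType d) (Pr : probability Omega R)
  (env : environment b Pr).
Context (A : nat -> Omega -> {set 'I_L}) (n : nat).
Context (past_A : forall t S, (t < n)%N -> past env t (A t.+1 @^-1` [set S])).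

Let cdraw t (e : 'I_L) om : R := clamp (tnth (draw env t om) e).

Let measurable_clamp_item (e : 'I_L) : measurable_fun setT
  (fun w : L.-tuple (measurableTypeR R) => clamp (tnth w e)).
Proof.
by apply: (measurableT_comp (@measurable_clamp R)); exact: measurable_tnth.
Qed.

Lemma ae_draw_cube :
  {ae Pr, forall om, forall t e, 0 <= tnth (draw env t om) e <= 1}.
Proof.
apply: ae_foralln => t; have [N [mN N0 sN]] := ae_law_cube b.
exists (draw env t @^-1` N); split.
- by rewrite -[X in measurable X]setTI; apply: measurable_funPT.
- have <- : distribution Pr (draw env t) N = 0%E by rewrite draw_law.
  by [].
- by move=> om /= nP; apply: sN => P; apply: nP.
Qed.

Lemma integrable_unit (f : Omega -> R) : measurable_fun setT f ->
  (forall om, 0 <= f om <= 1) -> Pr.-integrable setT (fun om => (f om)%:E).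
Proof.
move=> mf f01; apply: (@le_integrable _ _ _ Pr setT measurableT _ (cst 1%:E)) => //.
- exact/measurable_EFinP.
- by move=> om _ /=; rewrite lee_fin normr1 ger0_norm; case/andP: (f01 om).
- exact: finite_measure_integrable_cst.
Qed.

Lemma integral_item t (e : 'I_L) (G : Omega -> R) : adapted env t G ->
  (forall om, 0 <= G om <= 1) ->
  (\int[Pr]_om (G om * cdraw t.+1 e om)%:E =
   \int[Pr]_om (G om * wbar b e)%:E)%E.
Proof.
move=> mG G01; have G0 om : 0 <= G om by case/andP: (G01 om).
have mG' : measurable_fun setT G := adapted_measurable mG.
under eq_integral => om _ do rewrite EFinM /cdraw.
rewrite (ge0_integral_draw (G := fun om => (G om)%:E)
  (f := fun w => (clamp (tnth w e))%:E)) //.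
- rewrite wbarE; under [in RHS]eq_integral => om _ do rewrite EFinM.
  rewrite ge0_integralZr //; first exact/measurable_EFinP.
  + by move=> om _; rewrite lee_fin.
  + by rewrite lee_fin; case/andP: (wbar_itv b e).
- exact/measurable_EFinP.
- exact/measurable_EFinP.
- by move=> w; rewrite lee_fin; case/andP: (clamp_itv (tnth w e)).
Qed.

Let In (S : {set 'I_L}) (e : 'I_L) : R := (e \in S)%:R.

Let In01 S e : 0 <= In S e <= 1.
Proof. by rewrite /In; case: (e \in S); rewrite ?lexx ?ler01. Qed.

Let weightE (v : 'I_L -> R) S : weight v S = \sum_e In S e * v e.
Proof.
rewrite /weight big_mkcond; apply: eq_bigr => e _; rewrite /In.
by case: ifP; rewrite ?mul1r ?mul0r.
Qed.

Let adapted_In t e : (t < n)%N -> adapted env t (fun om => In (A t.+1 om) e).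
Proof.
move=> tn; have mA := adapted_mem past_A e tn.
have -> : (fun om => In (A t.+1 om) e) =
    (fun om => if e \in A t.+1 om then 1 else 0).
  by apply/funext => om; rewrite /In; case: ifP.
by rewrite /adapted in mA *; apply: measurable_fun_ifT.
Qed.

Lemma measurable_regret (v : 'I_L -> R) (As : {set 'I_L}) :
  measurable_fun setT (fun om => \sum_(1 <= t < n.+1)
    (weight v As - weight v (A t om))).
Proof.
have -> : (fun om => \sum_(1 <= t < n.+1) (weight v As - weight v (A t om))) =
    (fun om => \sum_(t < n) (weight v As - \sum_e In (A t.+1 om) e * v e)).
  apply/funext => om; rewrite big_add1 /= big_mkord.
  by apply: eq_bigr => t _; rewrite [weight _ (A _ _)]weightE.
apply: measurable_sum => t; apply: measurable_funB => //.
apply: measurable_sum => e; apply: measurable_funM => //.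
by apply: adapted_measurable (adapted_In e (ltn_ord t)).
Qed.

(** The action at step [t] is determined before draw [t], so this draw can be replaced by its mean.
    Splitting into items reduces the claim to products of an indicator known beforehand and one
    coordinate of the draw, which are integrable after clamping. *)
Lemma integral_regret (As : {set 'I_L}) :
  ('E_Pr[fun om => (\sum_(1 <= t < n.+1)
     (weight (tnth (draw env t om)) As -
      weight (tnth (draw env t om)) (A t om)))%R]
   = \int[Pr]_om (\sum_(1 <= t < n.+1)
       (weight (wbar b) As - weight (wbar b) (A t om)))%R%:E)%E.
Proof.
pose h (v : nat -> 'I_L -> Omega -> R) t e om :=
  ((In As e * v t.+1 e om)%R%:E - (In (A t.+1 om) e * v t.+1 e om)%R%:E)%E.
have hE (v : nat -> 'I_L -> Omega -> R) om :
    ((\sum_(1 <= t < n.+1)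
        (weight (v t ^~ om) As - weight (v t ^~ om) (A t om)))%R%:E
    = \sum_(t < n) \sum_e h v t e om)%E.
  rewrite big_add1 /= big_mkord -sumEFin; apply: eq_bigr => t _.
  by rewrite !weightE -sumrB -sumEFin; apply: eq_bigr => e _; rewrite EFinB.
pose vw (t : nat) e (om : Omega) := wbar b e.
have w01 e : 0 <= wbar b e <= 1 := wbar_itv b e.
have mc t e : measurable_fun setT (cdraw t e).
  exact: (measurableT_comp (measurable_clamp_item e)).
have mIn t e : (t < n)%N -> measurable_fun setT (fun om => In (A t.+1 om) e).
  by move=> tn; apply: adapted_measurable (adapted_In e tn).
have int1 (G v : Omega -> R) : measurable_fun setT G -> measurable_fun setT v ->
    (forall om, 0 <= G om <= 1) -> (forall om, 0 <= v om <= 1) ->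
    Pr.-integrable setT (fun om => (G om * v om)%:E).
  move=> mG mv G01 v01; apply: integrable_unit; first exact: measurable_funM.
  by move=> om; have := G01 om; have := v01 om; nra.
have inth (v : nat -> 'I_L -> Omega -> R) t e : (t < n)%N ->
    measurable_fun setT (v t.+1 e) -> (forall om, 0 <= v t.+1 e om <= 1) ->
    Pr.-integrable setT (h v t e).
  move=> tn mv v01; apply: integrableB => //; first exact: int1.
  by apply: int1 => //; exact: mIn.
have sumh (v : nat -> 'I_L -> Omega -> R) :
    (forall t e, measurable_fun setT (v t e)) ->
    (forall t e om, 0 <= v t e om <= 1) ->
    (\int[Pr]_om (\sum_(t < n) \sum_e h v t e om) =
     \sum_(t < n) \sum_e \int[Pr]_om h v t e om)%E.
  move=> mv v01; rewrite integral_sum // => [|t].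
    apply: eq_bigr => t _; rewrite integral_sum // => e.
    exact: inth.
  by apply: integrable_sum => // e _; exact: inth.
rewrite unlock.
(* Almost surely all draws equal their clamped versions. *)
transitivity (\int[Pr]_om (\sum_(t < n) \sum_e h cdraw t e om))%E.
  pose vd t (e : 'I_L) om : R := tnth (draw env t om) e.
  have mh (v : nat -> 'I_L -> Omega -> R) :
      (forall t e, measurable_fun setT (v t e)) ->
      measurable_fun setT (fun om => (\sum_(t < n) \sum_e h v t e om)%E).
    move=> mv; apply: emeasurable_sum => t; apply: emeasurable_sum => e.
    apply: emeasurable_funB; apply/measurable_EFinP; apply: measurable_funM => //.
    exact: mIn.
  under eq_integral => om _ do rewrite (hE vd).
  apply: ae_eq_integral => //.
  - apply: mh => t e.
    exact: (adapted_measurable (@adapted_draw_item _ _ _ _ _ _ _ env t e)).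
  - exact: mh.
  - have := ae_draw_cube.
    apply: (@filterS _ _ (ae_filter_ringOfSetsType Pr)) => om omC _.
    apply: eq_bigr => t _; apply: eq_bigr => e _.
    by rewrite /h /cdraw /vd clamp_id.
rewrite sumh //; last by move=> t e om; exact: clamp_itv.
under [RHS]eq_integral => om _ do rewrite (hE vw).
rewrite sumh; [|by move=> t e; exact: measurable_cst|by move=> t e om; exact: w01].
apply: eq_bigr => t _; apply: eq_bigr => e _.
have tn := ltn_ord t.
have c01 e' t' om : 0 <= cdraw t' e' om <= 1 by exact: clamp_itv.
have mI := mIn _ e tn.
have intIn S' (v : Omega -> R) : measurable_fun setT v -> (forall om, 0 <= v om <= 1) ->
    Pr.-integrable setT (fun om => (In S' e * v om)%:E).
  by move=> mv v01; apply: int1.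
have mw : measurable_fun setT (vw t.+1 e) by exact: measurable_cst.
have vw01 om : 0 <= vw t.+1 e om <= 1 by exact: w01.
rewrite /h [LHS]integralB ?[RHS]integralB //; try exact: intIn; try exact: int1.
congr (_ - _)%E.
  by apply: (integral_item e (G := fun=> In As e)) => //; exact: measurable_cst.
by apply: (integral_item e (G := fun om => In (A t.+1 om) e)) => //; exact: adapted_In.
Qed.

End MeanRegret.

(** * Runs of the algorithm *)

(** Passage from an extended gap to a real inverse [g]: the minimum is either +oo, when no index
    satisfies [P] and [g = 0], or a positive real. *)
Lemma inv_bigmin (R : realType) (I : finType) (P : pred I) (f : I -> R) :
  (forall i, P i -> 0 < f i) ->
  exists g : R, [/\ ((\big[Order.min/+oo]_(i | P i) (f i)%:E)^-1 = g%:E)%E,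
    0 <= g & forall i x, P i -> f i <= x -> 1 <= g * x].
Proof.
move=> f0; set m := \big[_/_]_(_ | _) _.
have [m_oo|[r r0 mE]] : m = +oo%E \/ exists2 r, 0 < r & m = r%:E.
  rewrite /m; elim/big_ind: _ => [|x y hx hy|i Pi]; first by left.
  - by rewrite /Order.min; case: ifP.
  - by right; exists (f i); rewrite ?f0.
- exists 0; rewrite m_oo invey; split=> // i x Pi _.
  have := @bigmin_le_cond _ _ _ +oo%E i P (fun i => (f i)%:E) Pi.
  by rewrite -/m m_oo leye_eq.
- exists r^-1; rewrite mE inver gt_eqF //; split=> // [|i x Pi fx].
    by rewrite invr_ge0 ltW.
  have := @bigmin_le_cond _ _ _ +oo%E i P (fun i => (f i)%:E) Pi.
  rewrite -/m mE lee_fin => rf.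
  by rewrite mulrC ler_pdivlMr // mul1r (le_trans rf).
Qed.

Section Run.
Context (R : realType) (L K : nat) (b : bandit R L K) (n : nat)
  (d : measure_display) (Omega : measurableType d) (Pr : probability Omega R)
  (X : iucb2_run b n Pr).
Context (K0 : (0 < K)%N) (Kn : (K %| n)%N).

Local Notation env := (env X).
Local Notation A := (action X).
Local Notation D := (decision X).
Local Notation B := (baseline X).

Lemma run_action_past t (S : {set 'I_L}) : (t < n)%N ->
  past env t (A t.+1 @^-1` [set S]).
Proof.
move=> tn; have iK : (t %% K < K)%N by rewrite ltn_mod.
have rn : (t %/ K < n %/ K)%N by rewrite ltn_divLR // divnK.
pose i := Ordinal iK; have tE : t = (t %/ K * K + i)%N by exact: divn_eq.
have AE om : A t.+1 om = exch X (t %/ K) om (out X (t %/ K) i om) |: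
    (B (t %/ K) om :\ out X (t %/ K) i om) by rewrite [in LHS]tE actionE.
rewrite -pastE.
(* The action is a function of three variables with finitely many values, so the event is a finite
   union. The exchange map and the baseline are known since the start of the round; the item taken
   out is known at time [t], which is the round's start plus [i]. *)
pose good (q : {ffun 'I_L -> 'I_L} * 'I_L * {set 'I_L}) :=
  q.1.1 q.1.2 |: (q.2 :\ q.1.2) == S.
rewrite [X in measurable X](_ : _ = \bigcup_(q in [set q | good q])
  (exch X (t %/ K) @^-1` [set q.1.1] `&` out X (t %/ K) i @^-1` [set q.1.2] `&`
   B (t %/ K) @^-1` [set q.2])); last first.
  apply/seteqP; split => om /=; rewrite AE.
    move=> eS; exists (exch X (t %/ K) om, out X (t %/ K) i om, B (t %/ K) om) => //.
    by rewrite /good /= eS.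
  by case=> [[[f o] S'] /= /eqP <-] [[/= -> ->] ->].
apply: fin_bigcup_measurable => [|[[f o] S'] _]; first exact: finite_finset.
have rt : (t %/ K * K <= t)%N by exact: leq_divM.
apply: measurableI; first apply: measurableI.
- by rewrite pastE; apply: (past_le rt); exact: exch_past.
- by rewrite pastE /= [in past _ t]tE; exact: out_past.
- by rewrite pastE; apply: (past_le rt); exact: baseline_past.
Qed.

(** * Actions and observations within one round *)

Section Round.
Context (r : nat) (om : Omega) (rn : (r < n %/ K)%N).

Let o i := out X r i om.
Let rho := exch X r om.

Let BB : B r om \in bases b.
Proof. by have [] := baselineP X om rn. Qed.

Let DB : D r om \in bases b.
Proof. by have [] := decisionP X om rn. Qed.

Let o_imset : [set o i | i in 'I_K]%SET = B r om.
Proof. exact: out_enum. Qed.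

Let o_inj : {in 'I_K &, injective o}.
Proof. by apply/imset_injP; rewrite o_imset (bases_rank BB) card_ord. Qed.

Let o_baseline i : o i \in B r om.
Proof. by rewrite -o_imset imset_f. Qed.

(** Otherwise the exchanged set would have only [K - 1] items. *)
Let exch_notin i : rho (o i) \notin (B r om :\ o i)%SET.
Proof.
apply/negP => h; have := bases_rank (exch_basis rn (o_baseline i)).
have /finset.setUidPr -> : ([set rho (o i)] \subset B r om :\ o i)%SET.
  by rewrite finset.sub1set.
move=> cK.
have := cardsD1 (o i) (B r om); rewrite cK o_baseline (bases_rank BB).
by move/eqP; rewrite -{1}[K]add0n eqn_add2r.
Qed.

Lemma action_basis (i : 'I_K) : A (r * K + i).+1 om \in bases b.
Proof. by rewrite actionE //; exact: (exch_basis rn (o_baseline i)). Qed.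

(** Over the round, each item of the baseline is taken out once and each item of the decision set is
    put in once. *)
Lemma round_regret (w : 'I_L -> R) (wA : R) :
  \sum_(i < K) (wA - weight w (A (r * K + i).+1 om)) =
  (K%:R - 1) * (wA - weight w (B r om)) + (wA - weight w (D r om)).
Proof.
have sumB (f : 'I_L -> R) : \sum_(i < K) f (o i) = \sum_(e in B r om) f e.
  by rewrite -o_imset big_imset //=; apply: eq_bigl => i; rewrite inE.
have sumD : \sum_(e in B r om) w (rho e) = weight w (D r om).
  rewrite /weight -(exch_onto X om rn) big_imset //.
  exact: exch_inj.
have actE (i : 'I_K) : weight w (A (r * K + i).+1 om) =
    w (rho (o i)) + (weight w (B r om) - w (o i)).
  rewrite actionE // /weight big_setU1 ?exch_notin //=; congr (_ + _).
  by rewrite [in RHS](big_setD1 (o i)) //= addrAC subrr add0r.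
under eq_bigr => i _ do rewrite actE.
rewrite sumrB sumr_const card_ord big_split /= sumrB sumr_const card_ord.
rewrite (sumB w) (sumB (fun e => w (rho e))) sumD -/(weight w (B r om)).
rewrite -[wA *+ K]mulr_natl -[weight _ _ *+ K]mulr_natl.
by move: (weight w (B r om)) (weight w (D r om)) K%:R => wB wD k; ring.
Qed.

Lemma nobs_round m e : (m <= K)%N -> nobs env A (r * K + m) om e =
  (nobs env A (r * K) om e + \sum_(i < K | (i < m)%N) (e \in A (r * K + i).+1 om))%N.
Proof.
elim: m => [_|m IHm mK]; first by rewrite addn0 big_pred0 ?addn0.
rewrite addnS nobsS IHm 1?ltnW // -addnA; congr (_ + _)%N.
rewrite [in RHS](bigD1 (Ordinal mK)) //= addnC; congr (_ + _)%N.
apply: eq_bigl => i; rewrite ltnS -val_eqE /= andbC.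
by rewrite ltn_neqAle.
Qed.

Lemma nobs_observed (i : 'I_K) e : e \in A (r * K + i).+1 om ->
  (nobs env A (r * K) om e < nobs env A (r.+1 * K) om e)%N.
Proof.
move=> eA; rewrite mulSn addnC nobs_round // -addn1 leq_add2l.
by rewrite (bigD1 i) //= eA.
Qed.

Lemma nobs_decision e :
  (nobs env A (r * K) om e + (e \in D r om) <= nobs env A (r.+1 * K) om e)%N.
Proof.
have [eD|_] := boolP (e \in D r om); last first.
  by rewrite addn0 mulSn [in leqRHS]addnC nobs_round // leq_addr.
move: eD; rewrite -(exch_onto X om rn) => /imsetP[x xB ->].
move: xB; rewrite -o_imset => /imsetP[i _ ->].
by rewrite addn1; apply: (@nobs_observed i); rewrite actionE // finset.setU11.
Qed.

(** When the baseline has at least two items, [e] stays in the action that takes out another one. *)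
Lemma nobs_baseline e : (1 < K)%N ->
  (nobs env A (r * K) om e + (e \in D r om :|: B r om) <=
   nobs env A (r.+1 * K) om e)%N.
Proof.
move=> K1; have := nobs_decision e; rewrite finset.in_setU.
have [eD|_] //= := boolP (e \in D r om).
have [eB|_] //= := boolP (e \in B r om).
move=> _; rewrite addn1.
have [x xB xe] : exists2 x, x \in B r om & x != e.
  have : (0 < #|B r om :\ e|)%N.
    have := cardsD1 e (B r om); rewrite eB (bases_rank BB) => KE.
    by rewrite -(ltn_add2l true) -KE addn0.
  by case/card_gt0P => x; rewrite !inE => /andP[xe xB]; exists x.
move: xB xe; rewrite -o_imset => /imsetP[i _ ->] oe.
by apply: (@nobs_observed i); rewrite actionE // finset.setU1r // !inE eq_sym oe.
Qed.

End Round.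
End Run.

Lemma sum_rounds (R : realType) (L N : nat) (S : {set 'I_L})
    (Q : nat -> {set 'I_L}) (f : nat -> 'I_L -> R) :
  \sum_(0 <= r < N) \sum_(e in S :&: Q r) f r e =
  \sum_(e in S) \sum_(0 <= r < N | e \in Q r) f r e.
Proof.
rewrite [RHS](eq_bigr (fun e => \sum_(0 <= r < N) if e \in Q r then f r e else 0)).
  rewrite exchange_big /=; apply: eq_bigr => r _; rewrite -big_mkcondr /=.
  by apply: eq_bigl => e; rewrite finset.in_setI.
by move=> e _; rewrite big_mkcond.
Qed.

(** * Regret of an accurate run *)

Section Total.
Context (R : realType) (L K : nat) (b : bandit R L K) (n : nat)
  (d : measure_display) (Omega : measurableType d) (Pr : probability Omega R)
  (X : iucb2_run b n Pr).
Context (K0 : (0 < K)%N) (Kn : (K %| n)%N) (n2 : (1 < n)%N).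
Context (As : {set 'I_L}) (hAs : max_basis b (wbar b) As)
  (hAs_unique : forall S : {set 'I_L}, max_basis b (wbar b) S -> S = As).

Local Notation env := (env X).
Local Notation A := (action X).
Local Notation D := (decision X).
Local Notation B := (baseline X).
Local Notation w := (wbar b).

Definition accurate t om e : Prop :=
  `|avg env A t om (nobs env A t om e) e - w e| <= Defs.radius R n (nobs env A t om e).

Definition inv_gap e : R := fine (gap b As e)^-1%E.
Definition inv_gap_star e : R := fine (gap_star b As e)^-1%E.
Definition inv_gap_base0 e : R := fine (gap_base0 b e)^-1%E.

Lemma inv_gapP e : [/\ (gap b As e)^-1%E = (inv_gap e)%:E, 0 <= inv_gap e &
  forall a x, a \in As -> w e < w a -> w a - w e <= x -> 1 <= inv_gap e * x].
Proof.
have [|g [gE g0 gP]] := @inv_bigmin R _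
  (fun a => (a \in As) && (w e < w a)) (fun a => w a - w e).
  by move=> a /andP[_]; rewrite subr_gt0.
rewrite /inv_gap /gap gE /=; split=> // a x aA lt le.
by apply: gP le; rewrite aA.
Qed.

Lemma inv_gap_starP a : [/\ (gap_star b As a)^-1%E = (inv_gap_star a)%:E,
  0 <= inv_gap_star a &
  forall e x, e \notin As -> w e < w a -> w a - w e <= x -> 1 <= inv_gap_star a * x].
Proof.
have [|g [gE g0 gP]] := @inv_bigmin R _
  (fun e => (e \in (~: As)%SET) && (w e < w a)) (fun e => w a - w e).
  by move=> e /andP[_]; rewrite subr_gt0.
rewrite /inv_gap_star /gap_star gE /=; split=> // e x eA lt le.
by apply: gP le; rewrite finset.in_setC eA.
Qed.

Lemma inv_gap_base0P e : [/\ (gap_base0 b e)^-1%E = (inv_gap_base0 e)%:E,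
  0 <= inv_gap_base0 e &
  forall a x, a \notin base0 b -> w e < w a -> w a - w e <= x ->
    1 <= inv_gap_base0 e * x].
Proof.
have [|g [gE g0 gP]] := @inv_bigmin R _
  (fun a => (a \in (~: base0 b)%SET) && (w e < w a)) (fun a => w a - w e).
  by move=> a /andP[_]; rewrite subr_gt0.
rewrite /inv_gap_base0 /gap_base0 gE /=; split=> // a x aB lt le.
by apply: gP le; rewrite finset.in_setC aB.
Qed.

Let rad r om e : R := Defs.radius R n (nobs env A (r * K) om e).

Lemma max_basis_unique (S : {set 'I_L}) : S \in bases b ->
  weight w As <= weight w S -> S = As.
Proof.
move=> BS le; apply: hAs_unique; split=> // S' BS'.
by apply: le_trans le; case: hAs => _; apply.
Qed.

Lemma round_accurate r om : (r < n %/ K)%N ->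
  (forall e, accurate (r * K) om e) ->
  weight w As - weight w (D r om) <=
    \sum_(e in D r om :\: As) pay 2 2 (inv_gap e) (rad r om e) /\
  weight w As - weight w (B r om) <=
    \sum_(e in As :&: D r om) pay 4 4 (inv_gap_star e) (rad r om e) +
    \sum_(e in (D r om :|: B r om) :\: As) pay 6 2 (inv_gap e) (rad r om e) +
    \sum_(e in B r om :&: base0 b) pay 4 4 (inv_gap_base0 e) (rad r om e).
Proof.
move=> rn acc.
have c0 e : 0 <= rad r om e by exact: sqrtr_ge0.
have w0 e : 0 <= w e by case/andP: (wbar_itv b e).
have accE e : w e - rad r om e <= avg env A (r * K) om (nobs env A (r * K) om e) e
    <= w e + rad r om e.
  by have := acc e; rewrite /accurate ler_distl.
pose U := ucb env A n (r * K) om.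
pose v := base_weight env A n (r * K) om.
have wU e : w e <= U e <= w e + 2 * rad r om e.
  by have := accE e; rewrite /U /ucb -/(rad r om e); lra.
have vB0 e : e \in base0 b -> w e <= v e <= w e + 2 * rad r om e.
  by move=> eB; rewrite /v /base_weight eB; exact: wU.
(* Truncating the lower bound at 0 keeps it below the mean, which is nonnegative. *)
have vNB0 e : e \notin base0 b -> w e - 2 * rad r om e <= v e <= w e.
  move=> /negPf eB; rewrite /v /base_weight eB /lcb -/(rad r om e).
  by have := accE e; have := w0 e; rewrite ge_max le_max; lra.
have [BBA maxA] := hAs; have [BBD maxD] := decisionP X om rn.
have [BBB maxB] := baselineP X om rn.
have gP a e x : a \in As -> e \notin As -> w e < w a -> w a - w e <= x ->
    1 <= inv_gap e * x.
  by move=> aA _; case: (inv_gapP e) => _ _; apply.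
have gsP a e x : a \in As -> e \notin As -> w e < w a -> w a - w e <= x ->
    1 <= inv_gap_star a * x.
  by move=> _; case: (inv_gap_starP a) => _ _; apply.
have g0P a e x : a \notin base0 b -> e \in base0 b -> w e < w a ->
    w a - w e <= x -> 1 <= inv_gap_base0 e * x.
  by move=> aB _; case: (inv_gap_base0P e) => _ _; apply.
split.
- apply: (@decision_regret _ (bases b) K _ _ _ _ _ U) => //.
  + exact: bases_exchange.
  + exact: bases_rank.
  + exact: max_basis_unique.
- apply: (@baseline_regret _ (bases b) K _ _ _ _ _ U v) => //.
  + exact: bases_exchange.
  + exact: bases_rank.
  + exact: max_basis_unique.
Qed.

Let ell : R := 3 / 2 * ln n%:R.

Let ln_n_ge0 : 0 <= ln n%:R :> R.
Proof. by rewrite ln_ge0 // ler1n ltnW. Qed.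

Let ell_ge0 : 0 <= ell.
Proof. by rewrite mulr_ge0. Qed.

(** After [N] observations the radius is [sqrt (ell / N)] with [ell = 3 / 2 * ln n], so the factor 2
    of [sum_pay_sqrt] becomes 3. *)
Lemma sum_pay_rounds om (S : {set 'I_L}) (Q : nat -> {set 'I_L}) (a t : R)
    (g : 'I_L -> R) : 0 <= a -> 0 <= t -> (forall e, 0 <= g e) ->
  (forall r e, (r < n %/ K)%N ->
    (nobs env A (r * K) om e + (e \in Q r) <= nobs env A (r.+1 * K) om e)%N) ->
  \sum_(0 <= r < n %/ K) \sum_(e in S :&: Q r) pay a t (g e) (rad r om e) <=
  3 * a * t * (\sum_(e in S) g e) * ln n%:R.
Proof.
move=> a0 t0 g0 inc.
rewrite (sum_rounds _ S Q (fun r e => pay a t (g e) (rad r om e))).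
rewrite mulr_sumr mulr_suml; apply: ler_sum => e _.
have -> : 3 * a * t * g e * ln n%:R = 2 * a * t * g e * ell.
  by rewrite /ell; field.
apply: (@sum_pay_sqrt _ a t (g e) ell (fun r => nobs env A (r * K) om e) _
  (fun r => e \in Q r)) => //.
by move=> r rn; exact: inc.
Qed.

Lemma sum_actions (F : nat -> R) :
  \sum_(1 <= t < n.+1) F t = \sum_(0 <= r < n %/ K) \sum_(i < K) F (r * K + i).+1.
Proof.
rewrite big_add1 /= -{1}(divnK Kn) big_nat_mul; apply: eq_bigr => r _.
rewrite -{1}[(r * K)%N]add0n big_addn mulSn addnK big_mkord.
by apply: eq_bigr => i _; rewrite addnC.
Qed.

Definition log_regret : R :=
  (K%:R - 1) * (48 * (\sum_(e in As) inv_gap_star e) +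
    36 * (\sum_(e in (~: As)%SET) inv_gap e) +
    48 * (\sum_(e in base0 b) inv_gap_base0 e)) * ln n%:R +
  24 * (\sum_(e in (~: As)%SET) inv_gap e) * ln n%:R.

Lemma log_regret_ge0 : 0 <= log_regret.
Proof.
have g0 e : 0 <= inv_gap e by case: (inv_gapP e).
have gs0 e : 0 <= inv_gap_star e by case: (inv_gap_starP e).
have gb0 e : 0 <= inv_gap_base0 e by case: (inv_gap_base0P e).
have k0 : 0 <= K%:R - 1 :> R by rewrite subr_ge0 ler1n.
by rewrite addr_ge0 // !mulr_ge0 // ?addr_ge0 // ?mulr_ge0 // ?sumr_ge0.
Qed.

Lemma regret_accurate om :
  (forall r e, (r < n %/ K)%N -> accurate (r * K) om e) ->
  \sum_(1 <= t < n.+1) (weight w As - weight w (A t om)) <= log_regret.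
Proof.
move=> acc; rewrite (sum_actions (fun t => weight w As - weight w (A t om))).
have g0 e : 0 <= inv_gap e by case: (inv_gapP e).
have gs0 e : 0 <= inv_gap_star e by case: (inv_gap_starP e).
have gb0 e : 0 <= inv_gap_base0 e by case: (inv_gap_base0P e).
rewrite (eq_big_nat _ _ (F2 := fun r => (K%:R - 1) * (weight w As - weight w (B r om)) +
    (weight w As - weight w (D r om)))); last first.
  by move=> r /andP[_ rn]; rewrite round_regret.
rewrite big_split /= -mulr_sumr.
have leD : \sum_(0 <= r < n %/ K) (weight w As - weight w (D r om)) <=
    24 * (\sum_(e in (~: As)%SET) inv_gap e) * ln n%:R.
  (* The decision sets cost [3 * 2 * 2 = 12], within the 24 of the bound. *)
  apply: (@le_trans _ _ (3 * 2 * 2 * (\sum_(e in (~: As)%SET) inv_gap e) * ln n%:R)).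
    apply: le_trans (sum_pay_rounds (om := om) (Q := fun r => D r om) _ _ _ g0 _) => //.
      apply: ler_sum_nat => r /andP[_ rn].
      rewrite finset.setIC -finset.setDE.
      by have [] := round_accurate rn (fun e => acc r e rn).
    by move=> r e rn; exact: nobs_decision.
  apply: ler_wpM2r => //; apply: ler_wpM2r; last lra.
  exact: sumr_ge0.
rewrite /log_regret lerD //.
(* For [K = 1] the factor [K - 1] cancels the baseline part; for larger [K] every item of the
   baseline is observed during the round. *)
have [K1|K1] := eqVneq K 1%N.
  have -> : K%:R - 1 = 0 :> R by rewrite K1 subrr.
  by rewrite !mul0r.
have {}K1 : (1 < K)%N by rewrite ltn_neqAle eq_sym K1.
have k0 : 0 <= K%:R - 1 :> R by rewrite subr_ge0 ler1n.
rewrite -(mulrA (K%:R - 1)).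
apply: ler_wpM2l => //.
rewrite mulrDl mulrDl.
apply: (@le_trans _ _ (\sum_(0 <= r < n %/ K)
   (\sum_(e in As :&: D r om) pay 4 4 (inv_gap_star e) (rad r om e) +
    \sum_(e in (D r om :|: B r om) :\: As) pay 6 2 (inv_gap e) (rad r om e) +
    \sum_(e in B r om :&: base0 b) pay 4 4 (inv_gap_base0 e) (rad r om e)))).
  apply: ler_sum_nat => r /andP[_ rn].
  by have [] := round_accurate rn (fun e => acc r e rn).
rewrite !big_split /=; apply: lerD; first apply: lerD.
- apply: le_trans (sum_pay_rounds (om := om) (Q := fun r => D r om) _ _ _ gs0 _) _
    => //.
    by move=> r e rn; exact: nobs_decision.
  by have -> : 3 * 4 * 4 = 48 :> R by ring.
- rewrite (eq_bigr (fun r => \sum_(e in (~: As)%SET :&: (D r om :|: B r om))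
      pay 6 2 (inv_gap e) (rad r om e))); last first.
    by move=> r _; rewrite finset.setIC -finset.setDE.
  apply: le_trans (sum_pay_rounds (om := om)
    (Q := fun r => (D r om :|: B r om)%SET) _ _ _ g0 _) _ => //.
    by move=> r e rn; exact: nobs_baseline.
  by have -> : 3 * 6 * 2 = 36 :> R by ring.
- rewrite (eq_bigr (fun r => \sum_(e in base0 b :&: B r om)
      pay 4 4 (inv_gap_base0 e) (rad r om e))); last first.
    by move=> r _; rewrite finset.setIC.
  apply: le_trans (sum_pay_rounds (om := om) (Q := fun r => B r om) _ _ _ gb0 _) _
    => //.
    move=> r e rn; apply: leq_trans (nobs_baseline X om rn e K1).
    by rewrite leq_add2l finset.in_setU; case: (e \in B r om); rewrite ?orbT.
  by have -> : 3 * 4 * 4 = 48 :> R by ring.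
Qed.

End Total.

(** * Regret of an inaccurate run, and integration over all runs *)

Section Penalty.
Context (R : realType) (L K : nat) (b : bandit R L K) (n : nat)
  (d : measure_display) (Omega : measurableType d) (Pr : probability Omega R)
  (X : iucb2_run b n Pr).
Context (K0 : (0 < K)%N) (Kn : (K %| n)%N) (n2 : (1 < n)%N).
Context (As : {set 'I_L}) (hAs : max_basis b (wbar b) As)
  (hAs_unique : forall S : {set 'I_L}, max_basis b (wbar b) S -> S = As).

Local Notation env := (env X).
Local Notation A := (action X).
Local Notation w := (wbar b).

Lemma nobs_gt0 t om e : (0 < nobs env A t om e)%N.
Proof. by []. Qed.

Lemma nobs_le t om e : (nobs env A t om e <= t.+1)%N.
Proof.
rewrite /nobs /observed /= size_map ltnS size_filter.
by apply: leq_trans (count_size _ _) _; rewrite size_iota.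
Qed.

Lemma sum_observed t om e : \sum_(x <- observed env A t om e) (x - w e) =
  (nobs env A t om e)%:R * (avg env A t om (nobs env A t om e) e - w e).
Proof.
rewrite mulrBr /avg mulrC divfK ?pnatr_eq0 -?lt0n ?nobs_gt0 //.
rewrite /nobs take_size; elim: (observed _ _ _ _ _) => [|x s IHs].
  by rewrite !big_nil mul0r subr0.
by rewrite !big_cons IHs /= -[(size s).+1]addn1 natrD; ring.
Qed.

(* The term whose sign is that of the deviation dev has the exponent
   4 s rho |dev| - 2 s rho ^ 2 >= 2 s rho ^ 2 = 3 ln n. *)
Lemma inaccurate_expmart t om e : ~ accurate X t om e ->
  n%:R ^+ 3 <=
  expmart env A e (4 * Defs.radius R n (nobs env A t om e)) t om +
  expmart env A e (- (4 * Defs.radius R n (nobs env A t om e))) t om.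
Proof.
move=> nacc; set s := nobs env A t om e; set rho := Defs.radius R n s.
set dev := avg env A t om s e - w e.
have n0 : 0 < n%:R :> R by rewrite ltr0n ltnW.
have ln0 : 0 <= ln n%:R :> R by rewrite ln_ge0 // ler1n ltnW.
have s0 : 0 < s%:R :> R by rewrite ltr0n nobs_gt0.
have srho : s%:R * rho ^+ 2 = 3 / 2 * ln n%:R.
  rewrite /rho sqr_sqrtr; first by rewrite mulrC divfK // gt_eqF.
  by rewrite divr_ge0 ?mulr_ge0 // ltW.
have n3 : n%:R ^+ 3 = expR (3 * ln n%:R) :> R.
  by rewrite expRM_natl lnK // posrE.
have rho0 : 0 <= rho by exact: sqrtr_ge0.
have lt : rho < `|dev| by rewrite ltNge; apply/negP => le; apply: nacc.
rewrite n3 /expmart sum_observed -/s -/dev.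
have M0 l : 0 <= expR (l * (s%:R * dev) - l ^+ 2 / 8 * s%:R) by exact: expR_ge0.
have [dev0|dev0] := leP 0 dev.
  rewrite ger0_norm // in lt.
  apply: le_trans (_ : _ <=
    expR (4 * rho * (s%:R * dev) - (4 * rho) ^+ 2 / 8 * s%:R)) _.
    rewrite ler_expR.
    have : s%:R * rho * rho <= s%:R * rho * dev by rewrite ler_wpM2l ?mulr_ge0 // ltW.
    move: srho; rewrite expr2; nra.
  by rewrite lerDl.
rewrite ltr0_norm // in lt.
apply: le_trans (_ : _ <=
    expR (- (4 * rho) * (s%:R * dev) - (- (4 * rho)) ^+ 2 / 8 * s%:R)) _.
  rewrite ler_expR.
  have : s%:R * rho * rho <= s%:R * rho * - dev by rewrite ler_wpM2l ?mulr_ge0 // ltW.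
  move: srho; rewrite expr2; nra.
by rewrite lerDr.
Qed.

(* s is a guess of the random number of observations of e before round r. *)
Definition expmart2 e r s om : R :=
  expmart env A e (4 * Defs.radius R n s) (r * K) om +
  expmart env A e (- (4 * Defs.radius R n s)) (r * K) om.

Lemma expmart2_ge0 e r s om : 0 <= expmart2 e r s om.
Proof. by rewrite addr_ge0 // expR_ge0. Qed.

(** Nonnegativity allows integrals to be compared without integrability of the dominating sum. *)
Lemma regret_ge0 om :
  0 <= \sum_(1 <= t < n.+1) (weight w As - weight w (A t om)).
Proof.
rewrite (sum_actions Kn (fun t => weight w As - weight w (A t om))).
rewrite big_nat; apply: sumr_ge0 => r /andP[_ rn]; apply: sumr_ge0 => i _.
by rewrite subr_ge0; case: hAs => _; apply; exact: action_basis.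
Qed.

Lemma regret_le om :
  \sum_(1 <= t < n.+1) (weight w As - weight w (A t om)) <= n%:R * K%:R.
Proof.
apply: (@le_trans _ _ (\sum_(1 <= t < n.+1) K%:R)); last first.
  by rewrite sumr_const_nat subn1 mulr_natl.
apply: ler_sum => t _; rewrite -[leRHS]subr0; apply: lerB.
  have [BA _] := hAs.
  have -> : K%:R = \sum_(e in As) 1 :> R by rewrite sumr_const (bases_rank BA).
  by apply: ler_sum => e _; case/andP: (wbar_itv b e).
by apply: sumr_ge0 => e _; case/andP: (wbar_itv b e).
Qed.

Lemma regret_le_expmart om :
  \sum_(1 <= t < n.+1) (weight w As - weight w (A t om)) <=
  log_regret b n As + n%:R * K%:R / n%:R ^+ 3 *
    \sum_(e : 'I_L) \sum_(r < n %/ K) \sum_(s < n.+2) expmart2 e r s om.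
Proof.
have n0 : 0 < n%:R :> R by rewrite ltr0n ltnW.
have sum0 : 0 <= \sum_(e : 'I_L) \sum_(r < n %/ K) \sum_(s < n.+2) expmart2 e r s om.
  by do 3!(apply: sumr_ge0 => ? _); exact: expmart2_ge0.
have k0 : 0 <= n%:R * K%:R / n%:R ^+ 3 :> R.
  by rewrite divr_ge0 ?mulr_ge0 ?exprn_ge0 // ltW.
have [acc|nacc] := pselect (forall r e, (r < n %/ K)%N -> accurate X (r * K) om e).
  apply: le_trans (regret_accurate K0 Kn n2 hAs hAs_unique acc) _.
  by rewrite lerDl mulr_ge0.
have [r [e [rn nac]]] : exists r e, (r < n %/ K)%N /\ ~ accurate X (r * K) om e.
  apply: contrapT => h; apply: nacc => r e rn; apply: contrapT => nac.
  by apply: h; exists r, e.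
apply: le_trans (regret_le om) _.
apply: (@le_trans _ _ (n%:R * K%:R / n%:R ^+ 3 * n%:R ^+ 3)).
  by rewrite divfK // expf_neq0 // gt_eqF.
apply: (@le_trans _ _ (n%:R * K%:R / n%:R ^+ 3 *
    \sum_(e : 'I_L) \sum_(r < n %/ K) \sum_(s < n.+2) expmart2 e r s om)); last first.
  by rewrite lerDr log_regret_ge0.
apply: ler_wpM2l => //.
(* With the initial one, at most [r * K + 1 <= n + 1] observations precede the round, so their true
   number is one of the values of [s]. The triple sum then contains the required term, and its other
   terms are nonnegative. *)
have sn : (nobs env A (r * K) om e < n.+2)%N.
  rewrite ltnS; apply: leq_trans (nobs_le _ _ _) _; rewrite ltnS.
  by rewrite -leq_divRL // ltnW.
apply: le_trans (inaccurate_expmart nac) _.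
rewrite (bigD1 e) //= (bigD1 (Ordinal rn)) //= (bigD1 (Ordinal sn)) //= -!addrA.
rewrite addrA lerDl !addr_ge0 //;
  repeat (apply: sumr_ge0 => ? _); exact: expmart2_ge0.
Qed.

Lemma integral_expmart2 e r s : (r < n %/ K)%N ->
  (\int[Pr]_om (expmart2 e r s om)%:E <= 2%:E)%E.
Proof.
move=> rn; have rKn : (r * K <= n)%N by rewrite -leq_divRL // ltnW.
have pA := run_action_past X K0 Kn.
have mM l : measurable_fun setT (fun om => (expmart env A e l (r * K) om)%:E).
  by apply/measurable_EFinP; apply: adapted_measurable (adapted_expmart pA e l rKn).
under eq_integral => om _ do rewrite EFinD.
rewrite ge0_integralD //.
have -> : (2%:E = 1%:E + 1%:E :> \bar R)%E by rewrite -EFinD; congr EFin; ring.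
- by apply: leeD; exact: (integral_expmart pA e _ rKn).
all: by move=> om _; rewrite lee_fin expR_ge0.
Qed.

(** Each of the [L * (n %/ K) * (n + 2)] terms of the dominating sum has integral at most 2, and the
    number of rounds is at most [n]. *)
Lemma regret_le_log :
  (regret X As <= (log_regret b n As)%:E +
    (n%:R * K%:R / n%:R ^+ 3 * (L%:R * (n%:R * (n.+2%:R * 2))))%:E)%E.
Proof.
have n0 : 0 < n%:R :> R by rewrite ltr0n ltnW.
have pA := run_action_past X K0 Kn.
have k0 : 0 <= n%:R * K%:R / n%:R ^+ 3 :> R.
  by rewrite divr_ge0 ?mulr_ge0 ?exprn_ge0 // ltW.
have log0 : 0 <= log_regret b n As by exact: log_regret_ge0.
have mE (e : 'I_L) (r : 'I_(n %/ K)) (s : 'I_n.+2) :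
    measurable_fun setT (fun om => (expmart2 e r s om)%:E).
  have rKn : (r * K <= n)%N by rewrite -leq_divRL // ltnW.
  apply/measurable_EFinP; apply: measurable_funD;
  exact: adapted_measurable (adapted_expmart pA e _ rKn).
have E0 e r s om : (0 <= (expmart2 e r s om)%:E)%E by rewrite lee_fin expmart2_ge0.
have sum3E (f : 'I_L -> 'I_(n %/ K) -> 'I_n.+2 -> R) :
    (\sum_(e < L) \sum_(r < n %/ K) \sum_(s < n.+2) (f e r s)%:E =
     (\sum_(e < L) \sum_(r < n %/ K) \sum_(s < n.+2) f e r s)%R%:E)%E.
  rewrite -sumEFin; apply: eq_bigr => e _; rewrite -sumEFin; apply: eq_bigr => r _.
  by rewrite sumEFin.
rewrite /regret (integral_regret pA).
pose k : R := n%:R * K%:R / n%:R ^+ 3.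
apply: (@le_trans _ _ (\int[Pr]_om ((log_regret b n As)%:E + k%:E *
    \sum_(e < L) \sum_(r < n %/ K) \sum_(s < n.+2) (expmart2 e r s om)%:E))%E).
  apply: ge0_le_integral => //.
  - by move=> om _; rewrite lee_fin regret_ge0.
  - by apply/measurable_EFinP; exact: (measurable_regret pA).
  - apply: emeasurable_funD => //; apply: emeasurable_funM => //.
    by do 3!(apply: emeasurable_sum => ?).
  - by move=> om _; rewrite sum3E -EFinM -EFinD lee_fin; exact: regret_le_expmart.
have mS : measurable_fun setT (fun om =>
    \sum_(e < L) \sum_(r < n %/ K) \sum_(s < n.+2) (expmart2 e r s om)%:E)%E.
  by do 3!(apply: emeasurable_sum => ?).
have S0 om : (0 <=
    \sum_(e < L) \sum_(r < n %/ K) \sum_(s < n.+2) (expmart2 e r s om)%:E)%E.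
  by do 3!(apply: sume_ge0 => ? _).
rewrite ge0_integralD //; last 2 first.
- by move=> om _; rewrite mule_ge0.
- by apply: emeasurable_funM.
rewrite integral_cst //= probability_setT mule1 leeD2l //.
rewrite ge0_integralZl // [leRHS]EFinM -/k lee_wpmul2l //.
rewrite ge0_integral_sum //; last 2 first.
- by move=> e; do 2!(apply: emeasurable_sum => ?).
- by move=> e om _; do 2!(apply: sume_ge0 => ? _).
apply: (@le_trans _ _ (\sum_(e < L) \sum_(r < n %/ K) \sum_(s < n.+2) 2%:E)%E).
  apply: lee_sum => e _; rewrite ge0_integral_sum //; last 2 first.
  - by move=> r; apply: emeasurable_sum => ?.
  - by move=> r om _; apply: sume_ge0 => ? _.
  apply: lee_sum => r _; rewrite ge0_integral_sum //.
  by apply: lee_sum => s _; exact: integral_expmart2.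
rewrite (sum3E (fun _ _ _ => 2)) lee_fin.
have -> : \sum_(e < L) \sum_(r < n %/ K) \sum_(s < n.+2) 2 =
    L%:R * ((n %/ K)%:R * (n.+2%:R * 2)) :> R.
  by rewrite !sumr_const !card_ord !mulr_natl.
apply: ler_wpM2l => //; apply: ler_wpM2r; first by rewrite mulr_ge0.
by rewrite ler_nat leq_div.
Qed.

End Penalty.

(** * Final form of the bound and size of the remainder *)

Lemma log_regretE (R : realType) (L K : nat) (b : bandit R L K) (n : nat)
    (As : {set 'I_L}) :
  ((log_regret b n As)%:E =
   (K%:R - 1)%:E *
     (48%:E * (\sum_(e' in As) (gap_star b As e')^-1) +
      36%:E * (\sum_(e in (~: As)%SET) (gap b As e)^-1) +
      48%:E * (\sum_(e' in base0 b) (gap_base0 b e')^-1)) * (ln n%:R)%:E +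
   24%:E * (\sum_(e in (~: As)%SET) (gap b As e)^-1) * (ln n%:R)%:E)%E.
Proof.
have -> : (\sum_(e' in As) (gap_star b As e')^-1 =
    (\sum_(e' in As) inv_gap_star b As e')%R%:E)%E.
  by rewrite -sumEFin; apply: eq_bigr => e _; case: (inv_gap_starP b As e).
have -> : (\sum_(e in (~: As)%SET) (gap b As e)^-1 =
    (\sum_(e in (~: As)%SET) inv_gap b As e)%R%:E)%E.
  by rewrite -sumEFin; apply: eq_bigr => e _; case: (inv_gapP b As e).
have -> : (\sum_(e' in base0 b) (gap_base0 b e')^-1 =
    (\sum_(e' in base0 b) inv_gap_base0 b e')%R%:E)%E.
  by rewrite -sumEFin; apply: eq_bigr => e _; case: (inv_gap_base0P b e).
by [].
Qed.

(** The left side equals [2 * K * L * (n + 2) / n], which is at most [4 * K * L] as [n >= 2]; the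
    factor [sqrt (ln n) / sqrt (ln 2)] is at least 1. *)
Lemma remainder_le (R : realType) (L K n : nat) : (1 < n)%N ->
  n%:R * K%:R / n%:R ^+ 3 * (L%:R * (n%:R * (n.+2%:R * 2))) <=
  4 / Num.sqrt (ln 2) * K%:R * L%:R * Num.sqrt (ln n%:R) :> R.
Proof.
move=> n1; have n0 : 0 < n%:R :> R by rewrite ltr0n ltnW.
have n2 : 2 <= n%:R :> R by rewrite ler_nat.
have ln2 : 0 < ln 2 :> R by rewrite ln_gt0 // ltr1n.
have s2 : 0 < Num.sqrt (ln 2) :> R by rewrite sqrtr_gt0.
apply: (@le_trans _ _ (4 * K%:R * L%:R)).
  have -> : n%:R * K%:R / n%:R ^+ 3 * (L%:R * (n%:R * (n.+2%:R * 2))) =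
      K%:R * L%:R * (2 * (n%:R + 2) / n%:R) :> R.
    by rewrite -[n.+2]addn2 natrD; field; rewrite gt_eqF.
  have -> : 4 * K%:R * L%:R = K%:R * L%:R * 4 :> R by ring.
  by rewrite ler_wpM2l // ler_pdivrMr //; lra.
have -> : 4 / Num.sqrt (ln 2) * K%:R * L%:R * Num.sqrt (ln n%:R) =
    4 * K%:R * L%:R * (Num.sqrt (ln n%:R) / Num.sqrt (ln 2)) :> R.
  by field; rewrite gt_eqF.
rewrite -[leLHS]mulr1 ler_wpM2l ?mulr_ge0 //.
by rewrite ler_pdivlMr // mul1r ler_wsqrtr // ler_ln // posrE ltr0n.
Qed.

Local Close Scope ring_scope.
Local Close Scope classical_set_scope.
Local Open Scope ereal_scope.

Theorem theorem4 (R : realType) :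
  exists C : R,
  forall (L K : nat) (b : bandit R L K) (hal : tol b = (K%:R^-1)%R)
    (As : {set 'I_L}) (hAs : max_basis b (wbar b) As)
    (hAs_unique : forall A : {set 'I_L}, max_basis b (wbar b) A -> A = As)
    (n : nat) (hn : (2 <= n)%N) (hKn : (K %| n)%N)
    (d : measure_display) (Omega : measurableType d)
    (Pr : probability Omega R) (X : iucb2_run b n Pr),
  exists2 c : R, (c <= C * K%:R * L%:R * Num.sqrt (ln n%:R))%R &
  regret X As <=
    (K%:R - 1)%:E *
      (48%:E * (\sum_(e' in As) (gap_star b As e')^-1) +
       36%:E * (\sum_(e in ~: As) (gap b As e)^-1) +
       48%:E * (\sum_(e' in base0 b) (gap_base0 b e')^-1)) * (ln n%:R)%:E +
    24%:E * (\sum_(e in ~: As) (gap b As e)^-1) * (ln n%:R)%:E + c%:E.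
Proof.
exists (4 / Num.sqrt (ln 2))%R => L K b _ As hAs uniq n n2 Kn d Omega Pr X.
(* A rank [K = 0] dividing [n] would force [n = 0]. *)
have K0 : (0 < K)%N.
  by rewrite lt0n; apply: contraTneq Kn => ->; rewrite dvd0n -lt0n ltnW.
exists (n%:R * K%:R / n%:R ^+ 3 * (L%:R * (n%:R * (n.+2%:R * 2))))%R.
  exact: remainder_le.
rewrite -log_regretE; exact: regret_le_log.
Qed.
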